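(* Let $N\ge2$ and let $\Omega\subset\mathbb{R}^N$ be any bounded open set with Lipschitz boundary. If $\beta<-1$, then $$\inf_{u\in BV(\Omega),\,u\not\equiv0}J(u)=-\infty.$$
   Context: For $u\in BV(\Omega)$, $u\not\equiv0$, $$J(u)=\frac{|Du|(\Omega)+\min(\beta,1)\int_{\partial\Omega}|u|\,d\mathcal{H}^{N-1}}{\int_\Omega|u|\,dx},$$ where $|Du|(\Omega)$ is the total variation of $u$ in $\Omega$ and, in the boundary integral, $u$ denotes the $BV$-trace of $u$ on $\partial\Omega$. $\Omega$ is nonempty. *)

(* Defs.v *)
From HB Require Import structures.
From mathcomp Require Import all_boot all_order all_algebra.
From mathcomp Require Import all_classical all_reals all_analysis.

Set Implicit Arguments.
Unset Strict Implicit.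
Unset Printing Implicit Defensive.
Import Order.TTheory GRing.Theory Num.Theory.
Import numFieldNormedType.Exports.

Local Open Scope classical_set_scope.
Local Open Scope ring_scope.

(* The canonical norm `|x| of 'rV[R]_n is the sup norm, hence the Euclidean
   structure below. *)
Section Euclidean.
Context {R : realType} {n : nat}.
Implicit Types (x y : 'rV[R]_n) (A : set 'rV[R]_n).

Definition enorm x : R := Num.sqrt (\sum_(i < n) x 0 i ^+ 2).

Definition eball x (r : R) : set 'rV[R]_n := [set y | enorm (y - x) < r].

Definition diam A : \bar R :=
  ereal_sup [set z | exists x y, [/\ A x, A y & z = (enorm (x - y))%:E]].

Definition boundary A : set 'rV[R]_n := closure A `\` interior A.

Lemma diam_ge0 A : A != set0 -> (0 <= diam A)%E.
Proof.
move=> /set0P[x Ax]; apply: (@le_trans _ _ (enorm (x - x))%:E).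
  by rewrite lee_fin sqrtr_ge0.
by apply: ereal_sup_ubound; exists x, x.
Qed.

End Euclidean.

Definition rV_display : measure_display.
Proof. exact: default_measure_display. Qed.

(* 'rV[R]_n carries the product sigma-algebra, generated by the coordinates;
   it is the Borel sigma-algebra. *)
Section measurable_rV.
Context {R : realType} (n : nat).

Definition rV_coord (i : 'I_n) (x : 'rV[R]_n) : measurableTypeR R := x 0 i.

Let rV_set0 : g_sigma_preimage rV_coord set0.
Proof. exact: sigma_algebra0. Qed.

Let rV_setC A : g_sigma_preimage rV_coord A -> g_sigma_preimage rV_coord (~` A).
Proof. exact: sigma_algebraC. Qed.

Let rV_bigcup (F : (set 'rV[R]_n)^nat) :
  (forall i, g_sigma_preimage rV_coord (F i)) ->
  g_sigma_preimage rV_coord (\bigcup_i (F i)).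
Proof. exact: sigma_algebra_bigcup. Qed.

HB.instance Definition _ := @isMeasurable.Build rV_display
  'rV[R]_n (g_sigma_preimage rV_coord) rV_set0 rV_setC rV_bigcup.

End measurable_rV.

Section lebesgue_rV.
Context {R : realType}.

Definition rV_cons n (p : measurableTypeR R * 'rV[R]_n) : 'rV[R]_n.+1 :=
  row_mx (p.1%:M : 'rV[R]_1) p.2.

Lemma measurable_rV_coord n (i : 'I_n) :
  measurable_fun [set: 'rV[R]_n] (rV_coord i).
Proof.
move=> _ Y mY; rewrite setTI; apply: sub_sigma_algebra => /=.
rewrite -bigcup_seq/=; exists i => /=; first by rewrite mem_index_enum.
by exists Y => //; rewrite setTI.
Qed.

Lemma measurable_rV_cons n : measurable_fun setT (@rV_cons n).
Proof.
move=> _; apply: (@measurability _ _ _ _ setT (@rV_cons n)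
  (\big[setU/set0]_(i < n.+1) preimage_set_system setT (@rV_coord R n.+1 i)
     measurable)) => //.
move=> _ [B + <-]; rewrite -bigcup_seq => -[i _ [C mC <-]].
rewrite !setTI -comp_preimage -[_ @^-1` _]setTI.
suff /(_ measurableT _ mC) : measurable_fun setT (rV_coord i \o @rV_cons n) by [].
case: (@split_ordP 1 n i) => j ->.
- rewrite (_ : _ \o _ = fst); first exact: measurable_fst.
  apply/funext => -[a y]; rewrite /= /rV_coord /rV_cons.
  by rewrite (@row_mxEl R 1 1 n) (ord1 j) mxE mulr1n.
- rewrite (_ : _ \o _ = rV_coord j \o snd).
    by apply: measurableT_comp; [exact: measurable_rV_coord|exact: measurable_snd].
  by apply/funext => -[a y]; rewrite /= /rV_coord /rV_cons (@row_mxEr R 1 1 n).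
Qed.

(* Iterated product measure: L^0 is the unit mass on the one-point space and
   L^(n+1) = L^1 x L^n, transported to 'rV[R]_n.+1 by rV_cons. *)
Definition lebesgue_rV_succ n (mu : {measure set 'rV[R]_n -> \bar R}) :
    set 'rV[R]_n.+1 -> \bar R :=
  pushforward (@lebesgue_measure R \x^ mu)%E (@rV_cons n).

Section succ_measure.
Variables (n : nat) (mu : {measure set 'rV[R]_n -> \bar R}).

Let succ0 : lebesgue_rV_succ mu set0 = 0%E.
Proof. by rewrite /lebesgue_rV_succ /pushforward preimage_set0 measure0. Qed.

Let succ_ge0 A : (0 <= lebesgue_rV_succ mu A)%E.
Proof. by apply: integral_ge0 => x _; exact: measure_ge0. Qed.

Let succ_sigma_additive : semi_sigma_additive (lebesgue_rV_succ mu).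
Proof.
rewrite /lebesgue_rV_succ; apply: measure_semi_sigma_additive.
exact: measurable_rV_cons.
Qed.

HB.instance Definition _ := isMeasure.Build _ _ _ (lebesgue_rV_succ mu)
  succ0 succ_ge0 succ_sigma_additive.

End succ_measure.

Fixpoint lebesgue_rV n : {measure set 'rV[R]_n -> \bar R} :=
  if n is m.+1 then lebesgue_rV_succ (lebesgue_rV m) else dirac (0 : 'rV[R]_0).

End lebesgue_rV.

(* mu_ext covers sets by measurable sets; on the copy allsets T of T, where
   every set is measurable, it covers by arbitrary sets. *)
Definition allsets (T : Type) : Type := T.

Definition allsets_display : measure_display.
Proof. exact: default_measure_display. Qed.

Section allsets.
Variable T : pointedType.

HB.instance Definition _ := Pointed.on (allsets T).
HB.instance Definition _ := @isMeasurable.Build allsets_display (allsets T)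
  setT I (fun _ _ => I) (fun _ _ => I).

End allsets.

(* k-dimensional Hausdorff measure on R^n, with the normalisation
   omega_k (diam / 2)^k, omega_k being the volume of the unit ball of R^k. *)
Section hausdorff.
Context {R : realType} {n : nat}.
Variable k : nat.
Implicit Types (A C : set 'rV[R]_n) (delta : R).
Local Open Scope ereal_scope.

Definition unit_ball_volume : \bar R := lebesgue_rV k (eball 0%R 1%R).

(* Sets of diameter larger than delta get weight +oo, which excludes them from
   the covers; set0 gets weight 0 even when k = 0. *)
Definition hausdorff_gauge delta C : \bar R :=
  if C == set0 then 0
  else if diam C <= delta%:E then unit_ball_volume * (diam C / 2%:E) ^+ k
  else +oo.

Lemma hausdorff_gauge0 delta : hausdorff_gauge delta set0 = 0.
Proof. by rewrite /hausdorff_gauge eqxx. Qed.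

Lemma hausdorff_gauge_ge0 delta C : 0 <= hausdorff_gauge delta C.
Proof.
rewrite /hausdorff_gauge; case: ifPn => // C0; case: ifPn => // _.
apply: mule_ge0; first exact: measure_ge0.
by apply: expe_ge0; apply: mule_ge0; rewrite ?diam_ge0 // inver pnatr_eq0 /= lee_fin.
Qed.

Definition hausdorff_pre delta A : \bar R :=
  mu_ext (hausdorff_gauge delta : set (allsets 'rV[R]_n) -> \bar R) A.

Definition hausdorff A : \bar R :=
  ereal_sup [set hausdorff_pre delta A | delta in [set d | (0 < d)%R]].

Let hausdorff_pre_ge0 delta A : 0 <= hausdorff_pre delta A.
Proof. exact/mu_ext_ge0/hausdorff_gauge_ge0. Qed.

Let hausdorff_pre_le delta A : (0 < delta)%R -> hausdorff_pre delta A <= hausdorff A.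
Proof. by move=> d0; apply: ereal_sup_ubound; exists delta. Qed.

Let hausdorff0 : hausdorff set0 = 0.
Proof.
apply/eqP; rewrite eq_le; apply/andP; split.
  apply: ge_ereal_sup => _ [d d0 <-].
  rewrite /hausdorff_pre mu_ext0 //; first exact: hausdorff_gauge0.
  exact: hausdorff_gauge_ge0.
exact: le_trans (hausdorff_pre_ge0 1 _) (hausdorff_pre_le _ ltr01).
Qed.

Let hausdorff_ge0 A : 0 <= hausdorff A.
Proof. exact: le_trans (hausdorff_pre_ge0 1 _) (hausdorff_pre_le _ ltr01). Qed.

Let le_hausdorff : {homo hausdorff : A B / A `<=` B >-> A <= B}.
Proof.
move=> A B AB; apply: ge_ereal_sup => _ [d d0 <-].
by apply: le_trans (hausdorff_pre_le _ d0); exact: le_mu_ext.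
Qed.

Let hausdorff_sigma_subadditive : sigma_subadditive hausdorff.
Proof.
move=> F; apply: ge_ereal_sup => _ [d d0 <-].
apply: le_trans (_ : \sum_(i <oo) hausdorff_pre d (F i) <= _).
  apply: mu_ext_sigma_subadditive; exact: hausdorff_gauge_ge0.
by apply: lee_nneseries => *; [exact: hausdorff_pre_ge0|exact: hausdorff_pre_le].
Qed.

HB.instance Definition _ := isOuterMeasure.Build R 'rV[R]_n hausdorff
  hausdorff0 hausdorff_ge0 le_hausdorff hausdorff_sigma_subadditive.

End hausdorff.
Arguments hausdorff {R n} k A.

Definition caratheodory_measure {R : realType} {T : pointedType}
    (mu : {outer_measure set T -> \bar R}) :
    {measure set (caratheodory_type mu) -> \bar R} :=
  (mu : set (caratheodory_type mu) -> \bar R).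

Definition hausdorff_measure {R : realType} {n : nat} (k : nat) :=
  caratheodory_measure (@hausdorff R n k).

(* (P, e) is an orthonormal frame of R^n: the point y has coordinates
   (y', y_n) = (y *m P^T, y *m e^T), and near x the set Omega is the strict
   epigraph {g(y') < y_n} of a Lipschitz function g on R^(n-1). *)
Definition lipschitz_boundary {R : realType} {n : nat} (Omega : set 'rV[R]_n) :=
  forall x, boundary Omega x ->
  exists (r : R) (P : 'M[R]_(n.-1, n)) (e : 'rV[R]_n) (g : 'rV[R]_n.-1 -> R)
    (L : R),
  [/\ 0 < r,
      [/\ P *m P^T = 1%:M, e *m P^T = 0 & e *m e^T = 1%:M],
      forall a b, `|g a - g b| <= L * enorm (a - b) &
      forall y, eball x r y ->
        (Omega y <-> g (y *m P^T) < (y *m e^T) 0 0)].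

Section BV.
Context {R : realType} {n : nat}.
Variable Omega : set 'rV[R]_n.
Local Notation leb := (@lebesgue_rV R n).

(* \tr ('J phi x) is sum_i d_i phi_i. *)
Definition divergence (phi : 'rV[R]_n -> 'rV[R]_n) x : R := \tr ('J phi x).

(* C^1_c(Omega; R^n), Euclidean norm at most 1 everywhere. *)
Definition test_field (phi : 'rV[R]_n -> 'rV[R]_n) : Prop :=
  [/\ (forall x, differentiable phi x) /\ continuous (jacobian phi),
      compact (closure [set x | phi x != 0]),
      closure [set x | phi x != 0] `<=` Omega &
      forall x, enorm (phi x) <= 1].

Definition dist_variation (u : 'rV[R]_n -> R) : \bar R :=
  ereal_sup [set (\int[leb]_(x in Omega) (u x * divergence phi x)%:E)%E
            | phi in test_field].

Definition BV (u : 'rV[R]_n -> R) : Prop :=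
  leb.-integrable Omega (EFin \o u) /\ (dist_variation u < +oo)%E.

(* l is the trace of u at x when r^(-n) times the integral of |u - l| over
   Omega `&` B(x, r) tends to 0 as r -> 0+. On a Lipschitz boundary such an l
   is unique, and for u in BV it exists H^(n-1)-almost everywhere; elsewhere
   bv_trace takes the junk value 0. *)
Definition is_trace_value (u : 'rV[R]_n -> R) x (l : R) : Prop :=
  ((r ^- n)%:E *
     \int[leb]_(y in Omega `&` eball x r) (`|u y - l|)%:E)%E @[r --> 0^'+]
  --> 0%E.

Definition bv_trace (u : 'rV[R]_n -> R) x : R := xget 0 (is_trace_value u x).

Definition J (beta : R) (u : 'rV[R]_n -> R) : \bar R :=
  ((dist_variation u +
    (Num.min beta 1)%:E *
      \int[hausdorff_measure n.-1]_(x in boundary Omega) (`|bv_trace u x|)%:E)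
   / \int[leb]_(x in Omega) (`|u x|)%:E)%E.

End BV.

(* Main.v *)
(* Let h be the supremum of the first coordinate x_0 over Omega and, for c < h,
   let u_c be the indicator of the cap {c <= x_0}. By the divergence theorem the
   variation of u_c in Omega is at most the area a(c) of the slice
   Omega cap {x_0 = c}. The trace of u_c is 1 on the part S_c of the boundary
   where x_0 > c, and the projection along the first axis maps S_c onto the
   slice without increasing distances, so that H^(N-1)(S_c) >= a(c). Hence
   J(u_c) <= (1 + beta) a(c) / F(c), where F(c) = int_c^h a is the volume of the
   cap. As F > 0 = F(h) and F' = - a, the quotient a / F is unbounded near h.

   With the normalisation omega_k (diam / 2)^k of the Hausdorff measure, the
   comparison H^k >= L^k is the isodiametric inequality, obtained here from the
   multiplicative Brunn-Minkowski inequality |A| |B| <= |C|^2 for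
   (A + B) / 2 included in C, itself proved by induction on the dimension from
   the Prekopa-Leindler inequality on the line. *)
Require Import Defs.
From HB Require Import structures.
From mathcomp Require Import all_boot all_order all_algebra.
From mathcomp Require Import all_classical all_reals all_analysis.
From mathcomp Require Import measurable_realfun ring lra.
Set Implicit Arguments.
Unset Strict Implicit.
Unset Printing Implicit Defensive.
Import Order.TTheory GRing.Theory Num.Theory.
Import numFieldNormedType.Exports.
Local Open Scope classical_set_scope.
Local Open Scope ring_scope.

(** * Slices of Lebesgue measure *)

Section volume.
Context {R : realType}.
Local Notation L1 := (@lebesgue_measure R).

(** Since 1 + beta is negative, the proof needs only an upper bound on the variation and a lower
    bound on the boundary integral; no equality of Gauss-Green type is established. Both bounds hold
    for every c, so the level need not be generic. The lower bound is the costly side. A comparison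
    H^k >= theta L^k with theta < 1 would replace 1 + beta by 1 + theta beta, which is not negative
    for beta close to -1. The constant must therefore be sharp, which is what the isodiametric
    inequality provides. Moreover [hausdorff_measure] integrates over the Caratheodory
    sigma-algebra, so S_c has to be shown measurable there, through the criterion for metric outer
    measures. The Lipschitz condition enters through the trace: it gives Omega positive lower
    density at boundary points, which makes the trace value unique. *)

Lemma rV_cons_0 n (t : R) (y : 'rV[R]_n) : rV_cons (t, y) 0 ord0 = t.
Proof.
have -> : ord0 = @lshift 1 n ord0 by exact/val_inj.
by rewrite /rV_cons (@row_mxEl R 1 1 n) mxE mulr1n.
Qed.

Lemma rV_cons_lift n (t : R) (y : 'rV[R]_n) i : rV_cons (t, y) 0 (lift ord0 i) = y 0 i.
Proof.
have -> : lift ord0 i = @rshift 1 n i by exact/val_inj.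
by rewrite /rV_cons (@row_mxEr R 1 1 n).
Qed.

Definition rV_tail n (x : 'rV[R]_n.+1) : 'rV[R]_n := \row_i x 0 (lift ord0 i).

Lemma rV_consK n (t : R) (y : 'rV[R]_n) : rV_tail (rV_cons (t, y)) = y.
Proof. by apply/rowP => i; rewrite mxE rV_cons_lift. Qed.

Lemma rV_consD n (s t : R) (x y : 'rV[R]_n) :
  rV_cons (s + t, x + y) = rV_cons (s, x) + rV_cons (t, y).
Proof.
apply/rowP => i; rewrite [RHS]mxE; case: (unliftP ord0 i) => [j|] ->.
  by rewrite !rV_cons_lift mxE.
by rewrite !rV_cons_0.
Qed.

Lemma rV_consZ n (a t : R) (x : 'rV[R]_n) :
  rV_cons (a * t, a *: x) = a *: rV_cons (t, x).
Proof.
apply/rowP => i; rewrite [RHS]mxE; case: (unliftP ord0 i) => [j|] ->.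
  by rewrite !rV_cons_lift mxE.
by rewrite !rV_cons_0.
Qed.

Lemma measurable_rV_consr n (t : R) : measurable_fun setT (fun y : 'rV[R]_n => rV_cons (t, y)).
Proof.
apply: (measurableT_comp (measurable_rV_cons (n := n))).
exact: pair1_measurable.
Qed.

Definition slice n (t : R) (A : set 'rV[R]_n.+1) : set 'rV[R]_n :=
  [set y | A (rV_cons (t, y))].

Lemma measurable_slice n t (A : set 'rV[R]_n.+1) :
  measurable A -> measurable (slice t A).
Proof. by move=> mA; rewrite -[slice t A]setTI; exact: measurable_rV_consr. Qed.

(** Boundedness is expressed by cubes because they are products of intervals: their finite measure
    follows by induction on n, and slices of a subset of a cube lie in a cube with the same K. *)
Definition cube n (K : R) : set 'rV[R]_n := [set x | forall i, `|x 0 i| <= K].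
Arguments cube n K : clear implicits.

Lemma measurable_cube n K : measurable (cube n K).
Proof.
rewrite (_ : cube n K = \bigcap_(i in [set: 'I_n]) (rV_coord i @^-1` `[- K, K]%classic)).
  apply: fin_bigcap_measurable => // i _.
  by rewrite -[_ @^-1` _]setTI; exact: measurable_rV_coord.
apply/seteqP; split => x h i; first by move=> _; rewrite /= in_itv/= -ler_norml; exact: h.
by have := h i I; rewrite /= in_itv/= -ler_norml.
Qed.

Lemma cubeS n K : @rV_cons R n @^-1` (cube n.+1 K) = `[- K, K]%classic `*` cube n K.
Proof.
apply/seteqP; split => -[t y] /=.
  move=> h; split; first by have := h ord0; rewrite rV_cons_0 ler_norml in_itv.
  by move=> i; have := h (lift ord0 i); rewrite rV_cons_lift.
move=> -[+ h2] i; rewrite in_itv/= -ler_norml => h1.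
by case: (unliftP ord0 i) => [j|] ->; rewrite ?rV_cons_lift ?rV_cons_0.
Qed.

Lemma lebesgue_cube_lty n K : (lebesgue_rV n (cube n K) < +oo)%E.
Proof.
elim: n => [|n IH].
  by rewrite /= diracE; case: (_ \in _); rewrite ltry.
rewrite [lebesgue_rV _ _]/= /lebesgue_rV_succ /pushforward cubeS.
rewrite product_measure2E//; last exact: measurable_cube.
rewrite lte_mul_pinfty//.
rewrite ge0_fin_numE//.
by have := lebesgue_measure_itv `[- K, K]; rewrite /= => ->; case: ifP => _; rewrite ltry.
Qed.

(* The same function as [lebesgue_rV n], named so that it can carry the
   sigma-finite instance. *)
Definition leb n : set 'rV[R]_n -> \bar R := lebesgue_rV n.
HB.instance Definition _ n := Measure.on (@leb n).

Lemma sigma_finite_leb n : sigma_finite setT (@leb n).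
Proof.
exists (fun k => cube n k%:R).
  apply/esym/seteqP; split => // x _.
  have [k hk] : exists k : nat, \sum_i `|x 0 i| <= k%:R.
    exists (Num.trunc (\sum_i `|x 0 i|)).+1.
    apply/ltW; have := @truncnS_gt R (\sum_i `|x 0 i|); exact.
  exists k => // i; apply: le_trans hk.
  by rewrite (bigD1 i)//= lerDl sumr_ge0.
by move=> k; split; [exact: measurable_cube|exact: lebesgue_cube_lty].
Qed.

HB.instance Definition _ n := Measure_isSigmaFinite.Build _ _ _ (@leb n) (@sigma_finite_leb n).

(** [lebesgue_rV] is built with [\x^], which integrates over the second factor. Integrating over the
    first coordinate instead rests on uniqueness of the product of sigma-finite measures, hence the
    copy [leb]. *)
Lemma leb_slice n (A : set 'rV[R]_n.+1) : measurable A ->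
  lebesgue_rV n.+1 A = (\int[L1]_t lebesgue_rV n (slice t A))%E.
Proof.
move=> mA.
have mA' : measurable (@rV_cons R n @^-1` A).
  by rewrite -[_ @^-1` A]setTI; exact: measurable_rV_cons.
transitivity ((L1 \x^ (@leb n))%E (@rV_cons R n @^-1` A)); first by [].
rewrite -(@product_measure_unique _ _ _ _ _ L1 (@leb n) (L1 \x^ (@leb n))%E)//.
  apply: eq_integral => t _; rewrite /leb; congr (lebesgue_rV n _).
  by apply/seteqP; split => y; rewrite /xsection/= inE.
by move=> X Y mX mY; exact: product_measure2E.
Qed.

Lemma measurable_leb_slice n (A : set 'rV[R]_n.+1) : measurable A ->
  measurable_fun setT (fun t : measurableTypeR R => lebesgue_rV n (slice t A) : \bar R).
Proof.
move=> mA.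
have mA' : measurable (@rV_cons R n @^-1` A).
  by rewrite -[_ @^-1` A]setTI; exact: measurable_rV_cons.
rewrite (_ : (fun t => _) = (@leb n) \o xsection (@rV_cons R n @^-1` A)).
  exact: measurable_fun_xsection.
apply/funext => t/=; congr (lebesgue_rV n _).
by apply/seteqP; split => y; rewrite /xsection/= inE.
Qed.

End volume.
Arguments cube {R} n K.
Arguments leb {R} n.

(** * The Prekopa-Leindler inequality on the line *)

Section prekopa_leindler.
Context {R : realType}.
Local Notation L1 := (@lebesgue_measure R).

Lemma measurable_affine (a b : R) :
  measurable_fun setT (fun x : measurableTypeR R => a * x + b : measurableTypeR R).
Proof.
apply: (@measurable_funD _ (measurableTypeR R) R setT (fun x => a * x) (fun=> b)).
  exact: mulrl_measurable.
exact: measurable_cst.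
Qed.

(** Lebesgue measure is determined by its values on half-open intervals, and the pushforward of [L1]
    by the affine map, scaled by a, has the same values. *)
Lemma lebesgue_preimage_affine_gt0 (a b : R) (A : set (measurableTypeR R)) :
  0 < a -> measurable A ->
  L1 ((fun x => a * x + b) @^-1` A) = ((a^-1)%:E * L1 A)%E.
Proof.
move=> a0 mA; pose f (x : measurableTypeR R) : measurableTypeR R := a * x + b.
have mf : measurable_fun setT f by exact: measurable_affine.
pose m0 : {measure set (measurableTypeR R) -> \bar R} :=
  measure_function_pushforward__canonical__measure_function_Measure L1 mf.
have a0' : 0 <= a by exact: ltW.
pose m : {measure set (measurableTypeR R) -> \bar R} := mscale (NngNum a0') m0.
have : L1 A = m A.
  apply: lebesgue_measure_unique => // _ [[u v] _ <-].
  change (L1 `]u, v]%classic = a%:E * L1 (f @^-1` `]u, v]%classic))%E.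
  rewrite (_ : f @^-1` _ = `](u - b) / a, (v - b) / a]%classic); last first.
    apply/seteqP; split => x /=; rewrite !in_itv/= /f ltr_pdivrMr// ler_pdivlMr//.
      by rewrite ltrBlDr lerBrDr mulrC.
    by rewrite ltrBlDr lerBrDr mulrC.
  rewrite !lebesgue_measure_itv/= !lte_fin ltr_pM2r ?invr_gt0// ltrD2r.
  case: ifPn => _; rewrite ?mule0// -!EFinD -EFinM; congr EFin.
  by field; rewrite gt_eqF.
move=> ->; change (L1 (f @^-1` A) = (a^-1)%:E * (a%:E * L1 (f @^-1` A)))%E.
by rewrite muleA -EFinM mulVf ?gt_eqF// mul1e.
Qed.

Lemma lebesgue_preimage_affine (a b : R) (A : set (measurableTypeR R)) :
  a != 0 -> measurable A ->
  L1 ((fun x => a * x + b) @^-1` A) = (`|a|^-1%:E * L1 A)%E.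
Proof.
move=> a0 mA; case: (ltrgt0P a) a0 => // a0.
  by move=> _; rewrite lebesgue_preimage_affine_gt0.
move=> _; rewrite -(lebesgue_preimage_affine_gt0 b _ mA) ?oppr_gt0//.
set B := (X in _ = L1 X).
have mB : measurable B.
  by rewrite -[B]setTI; exact: measurable_affine.
rewrite -(lebesgue_measureN mB) /pushforward; congr (L1 _).
by apply/seteqP; split => x; rewrite /B/= mulrNN.
Qed.

(* For x0 in X near sup X and y0 in Y near inf Y, the sets (X + y0) / 2 cut
   below (x0 + y0) / 2 and (x0 + Y) / 2 cut above it are disjoint parts of Z. *)
Lemma brunn_minkowski1 (K : R) (X Y Z : set (measurableTypeR R)) :
  measurable X -> measurable Y -> measurable Z ->
  X `<=` `[- K, K]%classic -> Y `<=` `[- K, K]%classic -> X !=set0 -> Y !=set0 ->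
  (forall x y, X x -> Y y -> Z ((x + y) / 2)) ->
  (L1 X + L1 Y <= 2%:E * L1 Z)%E.
Proof.
move=> mX mY mZ XK YK X0 Y0 XYZ.
have supX : has_sup X.
  by split => //; exists K => x /XK /=; rewrite in_itv/= => /andP[].
have infY : has_inf Y.
  by split => //; exists (- K) => x /YK /=; rewrite in_itv/= => /andP[].
apply/lee_addgt0Pr => e e0.
have e20 : 0 < e / 2 by rewrite divr_gt0.
have [x0 Xx0 x0s] := sup_adherent e20 supX.
have [y0 Yy0 y0s] := inf_adherent e20 infY.
pose m := (x0 + y0) / 2.
have mray : measurable (`]m, +oo[%classic : set (measurableTypeR R)) by exact: measurable_itv.
have step (W V : set (measurableTypeR R)) b : measurable W -> measurable V ->
    W `<=` (fun x => 2^-1 * x + b) @^-1` V -> (L1 W <= 2%:E * L1 V)%E.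
  move=> mW mV WV; rewrite -[2]invrK.
  rewrite -(lebesgue_preimage_affine_gt0 b) ?invr_gt0//.
  apply: le_measure => //; rewrite inE//.
  by rewrite -[X in measurable X]setTI; exact: measurable_affine.
have small (W : set (measurableTypeR R)) u v : measurable W -> W `<=` `[u, v]%classic -> u <= v ->
    (L1 W <= (v - u)%:E)%E.
  move=> mW Wuv uv; apply: (@le_trans _ _ (L1 `[u, v]%classic)).
    by apply: le_measure => //; rewrite inE//; exact: measurable_itv.
  by rewrite lebesgue_measure_itv/= lte_fin; case: ifPn => //; rewrite lee_fin subr_ge0.
have X1 : (L1 (X `&` ~` `]x0, +oo[%classic) <= 2%:E * L1 (Z `&` ~` `]m, +oo[%classic))%E.
  apply: (step _ _ (y0 / 2)).
  - by apply: measurableI => //; apply: measurableC; exact: measurable_itv.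
  - by apply: measurableI => //; exact: measurableC.
  move=> x [Xx] /=; rewrite !in_itv/= !andbT => /negP; rewrite -leNgt => xx0.
  split; first by rewrite [2^-1 * x]mulrC -mulrDl; exact: XYZ.
  by apply/negP; rewrite -leNgt /m; lra.
have Y1 : (L1 (Y `&` `]y0, +oo[%classic) <= 2%:E * L1 (Z `&` `]m, +oo[%classic))%E.
  apply: (step _ _ (x0 / 2)).
  - by apply: measurableI => //; exact: measurable_itv.
  - exact: measurableI.
  move=> x [Xx] /=; rewrite !in_itv/= !andbT => xx0.
  split; first by rewrite [2^-1 * x]mulrC -mulrDl addrC; exact: XYZ.
  by rewrite /m; lra.
have X2 : (L1 (X `&` `]x0, +oo[%classic) <= (e / 2)%:E)%E.
  rewrite (_ : e / 2 = x0 + e / 2 - x0); last by ring.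
  apply: small; [by apply: measurableI => //; exact: measurable_itv| |by lra].
  move=> x [Xx]/=; rewrite !in_itv/= andbT => xx0; rewrite (ltW xx0)/=.
  by have /= := sup_ubound (proj2 supX) Xx; lra.
have Y2 : (L1 (Y `&` ~` `]y0, +oo[%classic) <= (e / 2)%:E)%E.
  rewrite (_ : e / 2 = y0 - (y0 - e / 2)); last by ring.
  apply: small; [by apply: measurableI => //; apply: measurableC; exact: measurable_itv| |by lra].
  move=> x [Xx]/=; rewrite !in_itv/= andbT => /negP; rewrite -leNgt => xx0.
  rewrite xx0 andbT.
  by have /= := inf_lbound (proj2 infY) Xx; lra.
have split1 (W : set (measurableTypeR R)) u : measurable W ->
    L1 W = (L1 (W `&` ~` `]u, +oo[%classic) + L1 (W `&` `]u, +oo[%classic))%E.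
  move=> mW; rewrite -setDE; apply: measureDI => //; exact: measurable_itv.
rewrite (split1 X x0)// (split1 Y y0)// (split1 Z m)//.
rewrite ge0_muleDr// [in X in (_ <= _ + X)%E](splitr e) (EFinD (e / 2)).
rewrite [X in (_ + X <= _)%E]addeC [X in (_ <= X)%E]addeACA.
by apply: leeD; apply: leeD.
Qed.

(** The condition 0 <= l is built in so that the layer-cake integral can run over all real l. *)
Definition level (f : measurableTypeR R -> R) (l : R) : set (measurableTypeR R) :=
  [set x | 0 <= l < f x].

(** Both integrals are the area of the region [D] under the graph, cut vertically or horizontally,
    and agree by Tonelli. *)
Lemma layer_cake (f : measurableTypeR R -> R) :
  measurable_fun setT f -> (forall x, 0 <= f x) ->
  (\int[L1]_x (f x)%:E = \int[L1]_l L1 (level f l))%E /\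
  measurable_fun setT (fun l : measurableTypeR R => L1 (level f l)) /\
  forall l, measurable (level f l).
Proof.
move=> mf f0.
pose D : set (measurableTypeR R * measurableTypeR R) := [set p | 0 <= p.2 < f p.1].
have mD : measurable D.
  pose f1 (p : measurableTypeR R * measurableTypeR R) : bool := (0 <= p.2)%R.
  pose f2 (p : measurableTypeR R * measurableTypeR R) : bool := (p.2 < f p.1)%R.
  rewrite (_ : D = f1 @^-1` [set true] `&` f2 @^-1` [set true]); last first.
    by apply/seteqP; split => p => /= /andP.
  apply: measurableI.
  - have : measurable_fun setT f1 by apply: measurable_fun_ler => //; exact: measurable_snd.
    by move=> /(_ measurableT [set true]); rewrite setTI; exact.
  - have : measurable_fun setT f2.
      apply: measurable_fun_ltr; first exact: measurable_snd.
      by apply: measurableT_comp => //; exact: measurable_fst.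
    by move=> /(_ measurableT [set true]); rewrite setTI; exact.
have yE l : ysection D l = (level f l).
  by apply/seteqP; split => x; rewrite /ysection/= inE.
have xE x : xsection D x = `[0, f x[%classic.
  by apply/seteqP; split => l; rewrite /xsection/= inE /D/= in_itv.
split; last split.
- transitivity (\int[L1]_x L1 (xsection D x))%E.
    apply: eq_integral => x _; rewrite xE lebesgue_measure_itv/= lte_fin.
    rewrite sube0; case: ltP => // fx.
    by congr EFin; apply/eqP; rewrite eq_le fx f0.
  transitivity (\int[L1]_y L1 (ysection D y))%E.
    have := indic_fubini_tonelli L1 L1 mD.
    by rewrite indic_fubini_tonelli_FE// indic_fubini_tonelli_GE.
  by apply: eq_integral => y _; rewrite yE.
- rewrite (_ : (fun l => _) = L1 \o ysection D); first exact: measurable_fun_ysection.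
  by apply/funext => l /=; rewrite yE.
- by move=> l; rewrite -yE; exact: measurable_ysection.
Qed.

(** With suprema equal to 1, the level sets of f and g are both nonempty for 0 <= l < 1, as the
    one-dimensional Brunn-Minkowski inequality requires, and both empty for other l. Their midpoints
    lie in the level set of h, because f s > l and g t > l force h ((s + t) / 2) ^+ 2 > l ^+ 2. *)
Lemma prekopa_leindler_normalized (K : R) (f g h : measurableTypeR R -> R) :
  measurable_fun setT f -> measurable_fun setT g -> measurable_fun setT h ->
  (forall x, 0 <= f x <= 1) -> (forall x, 0 <= g x <= 1) -> (forall x, 0 <= h x) ->
  (forall x, K < `|x| -> f x = 0) -> (forall x, K < `|x| -> g x = 0) ->
  (forall l, l < 1 -> exists x, l < f x) -> (forall l, l < 1 -> exists x, l < g x) ->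
  (forall s t, f s * g t <= h ((s + t) / 2) ^+ 2) ->
  (\int[L1]_x (f x)%:E + \int[L1]_x (g x)%:E <= 2%:E * \int[L1]_x (h x)%:E)%E.
Proof.
move=> mf mg mh f01 g01 h0 fK gK fs gs fgh.
have f0 x : 0 <= f x by have /andP[] := f01 x.
have g0 x : 0 <= g x by have /andP[] := g01 x.
have [fE [mfl mfl']] := layer_cake mf f0.
have [gE [mgl mgl']] := layer_cake mg g0.
have [hE [mhl mhl']] := layer_cake mh h0.
rewrite fE gE hE -ge0_integralZl//.
rewrite -ge0_integralD//; apply: ge0_le_integral => //.
- by move=> l _; exact: adde_ge0.
- exact: emeasurable_funD.
- exact: measurable_funeM.
move=> l _; have [l0|l0] := ltP l 0.
  rewrite (_ : (level f l) = set0); last first.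
    by apply/seteqP; split => // x; rewrite /level/= leNgt l0.
  rewrite (_ : (level g l) = set0); last first.
    by apply/seteqP; split => // x; rewrite /level/= leNgt l0.
  by rewrite measure0 adde0 mule_ge0.
have [l1|l1] := ltP l 1; last first.
  rewrite (_ : (level f l) = set0); last first.
    by apply/seteqP; split => // x /= /andP[_]; have /andP[_] := f01 x; lra.
  rewrite (_ : (level g l) = set0); last first.
    by apply/seteqP; split => // x /= /andP[_]; have /andP[_] := g01 x; lra.
  by rewrite measure0 adde0 mule_ge0.
apply: (@brunn_minkowski1 K) => //.
- move=> x /= /andP[_ lf]; rewrite in_itv/= -ler_norml leNgt; apply/negP => /fK; lra.
- move=> x /= /andP[_ lf]; rewrite in_itv/= -ler_norml leNgt; apply/negP => /gK; lra.
- by have [x lx] := fs _ l1; exists x; rewrite /level/= l0.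
- by have [x lx] := gs _ l1; exists x; rewrite /level/= l0.
move=> x y /= /andP[_ lf] /andP[_ lg]; rewrite /level/= l0/=.
rewrite -ltr_sqr ?nnegrE//; apply: lt_le_trans (fgh x y).
by rewrite expr2 ltr_pM.
Qed.

(** Dividing f and g by their suprema a and b, and h by the square root of a b, preserves the
    hypothesis and reduces to the normalized case. The additive inequality u + v <= 2 w obtained
    there becomes u v <= w ^+ 2 by the arithmetic-geometric mean inequality. *)
Lemma prekopa_leindler1 (K M : R) (f g h : measurableTypeR R -> R) :
  measurable_fun setT f -> measurable_fun setT g -> measurable_fun setT h ->
  (forall x, 0 <= f x <= M) -> (forall x, 0 <= g x <= M) -> (forall x, 0 <= h x) ->
  (forall x, K < `|x| -> f x = 0) -> (forall x, K < `|x| -> g x = 0) ->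
  (forall s t, f s * g t <= h ((s + t) / 2) ^+ 2) ->
  (\int[L1]_x (f x)%:E * \int[L1]_x (g x)%:E <=
   \int[L1]_x (h x)%:E * \int[L1]_x (h x)%:E)%E.
Proof.
move=> mf mg mh f01 g01 h0 fK gK fgh.
have f0 x : 0 <= f x by have /andP[] := f01 x.
have g0 x : 0 <= g x by have /andP[] := g01 x.
have int0 (k : measurableTypeR R -> R) : (forall x, 0 <= k x) -> (0 <= \int[L1]_x (k x)%:E)%E.
  by move=> k0; apply: integral_ge0 => x _; rewrite lee_fin.
have sup_props (k : measurableTypeR R -> R) : (forall x, 0 <= k x <= M) ->
    (forall x, k x = 0) \/
    exists a, [/\ 0 < a, forall x, k x <= a & forall l, l < a -> exists x, l < k x].
  move=> kM; have hs : has_sup (range k).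
    by split; [exists (k 0), 0|exists M => _ [x _ <-]; have /andP[] := kM x].
  have ub x : k x <= sup (range k) by apply: (sup_ubound (proj2 hs)); exists x.
  have [s0|s0] := leP (sup (range k)) 0.
    left => x; apply/eqP; rewrite eq_le; have /andP[-> _] := kM x.
    by rewrite andbT (le_trans (ub x)).
  right; exists (sup (range k)); split => // l ls.
  have d0 : 0 < sup (range k) - l by rewrite subr_gt0.
  have [_ [x _ <-] lx] := sup_adherent d0 hs.
  by exists x; move: lx; rewrite opprB addrC subrK.
have [f00|[a [a0 fa las]]] := sup_props _ f01.
  rewrite (eq_integral (cst 0%E)) ?integral0 ?mul0e ?mule_ge0 ?int0//.
  by move=> x _; rewrite f00.
have [g00|[b [b0 gb lbs]]] := sup_props _ g01.
  rewrite [X in (_ * X <= _)%E](eq_integral (cst 0%E)) ?integral0 ?mule0 ?mule_ge0 ?int0//.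
  by move=> x _; rewrite g00.
have ab0 : 0 < a * b by rewrite mulr_gt0.
pose c := Num.sqrt (a * b).
have c0 : 0 < c by rewrite sqrtr_gt0.
have cc : c ^+ 2 = a * b by rewrite sqr_sqrtr// ltW.
have Z (k : measurableTypeR R -> R) d : 0 < d -> measurable_fun setT k -> (forall x, 0 <= k x) ->
    (\int[L1]_x (k x)%:E = d%:E * \int[L1]_x (k x / d)%:E)%E.
  move=> d0 mk k0; rewrite -ge0_integralZl//.
  - by apply: eq_integral => x _; rewrite -EFinM mulrCA divff ?gt_eqF// mulr1.
  - by apply/measurable_EFinP; exact: measurable_funM.
  - by move=> x _; rewrite lee_fin divr_ge0// (ltW d0).
  - by rewrite lee_fin ltW.
have fin (k : measurableTypeR R -> R) d : 0 < d -> measurable_fun setT k ->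
    (forall x, 0 <= k x <= d) -> (forall x, K < `|x| -> k x = 0) -> (\int[L1]_x (k x / d)%:E < +oo)%E.
  move=> d0 mk kd kK.
  apply: (@le_lt_trans _ _ (\int[L1]_x (\1_(`[- K, K]%classic) x)%:E)%E).
    apply: ge0_le_integral => //.
    - by move=> x _; rewrite lee_fin divr_ge0 ?(ltW d0)//; have /andP[] := kd x.
    - by apply/measurable_EFinP; exact: measurable_funM.
    - by apply/measurable_EFinP; apply: measurable_indic; exact: measurable_itv.
    move=> x _; rewrite lee_fin indicE; have [xK|xK] := leP `|x| K.
      rewrite mem_set/=; last by rewrite in_itv/= -ler_norml.
      by rewrite ler_pdivrMr// mul1r; have /andP[] := kd x.
    by rewrite kK// mul0r.
  rewrite integral_indic//.
  rewrite setIT; have := lebesgue_measure_itv `[- K, K].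
  by rewrite /= => ->; case: ifPn => _; rewrite ?ltry.
have main := @prekopa_leindler_normalized K
  (fun x => f x / a) (fun x => g x / b) (fun x => h x / c).
have {main} : (\int[L1]_x (f x / a)%:E + \int[L1]_x (g x / b)%:E <=
    2%:E * \int[L1]_x (h x / c)%:E)%E.
  apply: main.
  - exact: measurable_funM.
  - exact: measurable_funM.
  - exact: measurable_funM.
  - by move=> x; rewrite divr_ge0 ?(ltW a0)//= ler_pdivrMr// mul1r fa.
  - by move=> x; rewrite divr_ge0 ?(ltW b0)//= ler_pdivrMr// mul1r gb.
  - by move=> x; rewrite divr_ge0 ?(ltW c0).
  - by move=> x /fK ->; rewrite mul0r.
  - by move=> x /gK ->; rewrite mul0r.
  - move=> l l1; have [|x lx] := las (l * a); first by rewrite -[ltRHS]mul1r ltr_pM2r.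
    by exists x; rewrite ltr_pdivlMr.
  - move=> l l1; have [|x lx] := lbs (l * b); first by rewrite -[ltRHS]mul1r ltr_pM2r.
    by exists x; rewrite ltr_pdivlMr.
  - move=> s t; rewrite mulrACA -invfM expr_div_n cc ler_pM2r ?invr_gt0//.
rewrite (Z f a)// (Z g b)// (Z h c)//.
have fu : (\int[L1]_x (f x / a)%:E)%E \is a fin_num.
  rewrite ge0_fin_numE ?fin// => [x|]; first by rewrite f0 fa.
  by apply: int0 => x; rewrite divr_ge0 ?(ltW a0).
have fv : (\int[L1]_x (g x / b)%:E)%E \is a fin_num.
  rewrite ge0_fin_numE ?fin// => [x|]; first by rewrite g0 gb.
  by apply: int0 => x; rewrite divr_ge0 ?(ltW b0).
have := int0 (fun x => f x / a) (fun x => divr_ge0 (f0 x) (ltW a0)).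
have := int0 (fun x => g x / b) (fun x => divr_ge0 (g0 x) (ltW b0)).
have := int0 (fun x => h x / c) (fun x => divr_ge0 (h0 x) (ltW c0)).
rewrite -(fineK fu) -(fineK fv).
move: (fine _) (fine _) (\int[L1]_x (h x / c)%:E)%E => u v [w| |] //.
  rewrite -!EFinM -EFinD !lee_fin => w0 v0 u0 uvw.
  rewrite (_ : a * u * (b * v) = c ^+ 2 * (u * v)); last by rewrite cc; ring.
  rewrite (_ : c * w * (c * w) = c ^+ 2 * w ^+ 2); last by ring.
  rewrite ler_pM2l ?exprn_gt0//.
  have uvw2 : (u + v) ^+ 2 <= (2 * w) ^+ 2.
    by rewrite ler_sqr// nnegrE ?addr_ge0// (le_trans _ uvw)// addr_ge0.
  rewrite (_ : u * v = ((u + v) ^+ 2 - (u - v) ^+ 2) / 4); last by field.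
  rewrite (_ : w ^+ 2 = (2 * w) ^+ 2 / 4); last by field.
  rewrite ler_pM2r ?invr_gt0 ?ltr0n//; apply: le_trans uvw2.
  by rewrite lerBlDr lerDl sqr_ge0.
(* No upper bound on h is assumed, so its integral may be infinite; the right-hand side is then
   +oo. *)
by move=> _ _ _ _; rewrite gt0_muley ?lte_fin// mulyy leey.
Qed.

End prekopa_leindler.

(** * Brunn-Minkowski and isodiametric inequalities *)

Section isodiametric.
Context {R : realType}.
Local Notation L1 := (@lebesgue_measure R).

Lemma slice_cube n (K t : R) (A : set 'rV[R]_n.+1) :
  A `<=` cube n.+1 K -> slice t A `<=` cube n K.
Proof. by move=> AK y /AK h i; have := h (lift ord0 i); rewrite rV_cons_lift. Qed.

Lemma slice_cube0 n (K t : R) (A : set 'rV[R]_n.+1) :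
  A `<=` cube n.+1 K -> K < `|t| -> slice t A = set0.
Proof.
move=> AK Kt; apply/seteqP; split => // y /AK /(_ ord0).
by rewrite rV_cons_0 leNgt Kt.
Qed.

Lemma lebesgue_fin n (K : R) (A : set 'rV[R]_n) : measurable A ->
  A `<=` cube n K -> lebesgue_rV n A \is a fin_num.
Proof.
move=> mA AK; rewrite ge0_fin_numE//; apply: le_lt_trans (lebesgue_cube_lty n K).
by apply: le_measure => //; rewrite inE//; exact: measurable_cube.
Qed.

(** C is a given measurable set because the set of midpoints of A and B need not be measurable. The
    induction hypothesis, applied to the slices of A, B, C at s, t, (s + t) / 2, is the pointwise
    hypothesis of the Prekopa-Leindler inequality for the slice volumes. *)
Theorem brunn_minkowski n (K : R) (A B C : set 'rV[R]_n) :
  measurable A -> measurable B -> measurable C ->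
  A `<=` cube n K -> B `<=` cube n K -> C `<=` cube n K ->
  (forall x y, A x -> B y -> C (2^-1 *: (x + y))) ->
  (lebesgue_rV n A * lebesgue_rV n B <= lebesgue_rV n C * lebesgue_rV n C)%E.
Proof.
elim: n A B C => [|n IH] A B C mA mB mC AK BK CK ABC.
  rewrite /= !diracE; have [|] := boolP (_ \in A); last by rewrite mul0e mule_ge0.
  have [|] := boolP (_ \in B); last by rewrite mule0 mule_ge0.
  rewrite !inE => B0 A0; rewrite mem_set//.
  by have := ABC _ _ A0 B0; rewrite addr0 scaler0.
have fin D t : measurable D -> D `<=` cube n.+1 K -> lebesgue_rV n (slice t D) \is a fin_num.
  by move=> mD DK; apply: (@lebesgue_fin _ K); [exact: measurable_slice|exact: slice_cube].
pose f D (t : measurableTypeR R) : R := fine (lebesgue_rV n (slice t D)).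
have f0 D t : 0 <= f D t by exact: fine_ge0.
have mf D : measurable D -> measurable_fun setT (f D).
  by move=> mD; apply: measurableT_comp => //; exact: measurable_leb_slice.
have intf D : measurable D -> D `<=` cube n.+1 K ->
    lebesgue_rV n.+1 D = (\int[L1]_t (f D t)%:E)%E.
  move=> mD DK; rewrite leb_slice//; apply: eq_integral => t _.
  by rewrite /f fineK// fin.
have fM D t : measurable D -> D `<=` cube n.+1 K -> 0 <= f D t <= fine (lebesgue_rV n (cube n K)).
  move=> mD DK; rewrite f0/= fine_le//; first exact: fin.
    by apply: (@lebesgue_fin _ K) => //; exact: measurable_cube.
  apply: le_measure; rewrite ?inE; [exact: measurable_slice|exact: measurable_cube|].
  exact: slice_cube.
have fK D t : D `<=` cube n.+1 K -> K < `|t| -> f D t = 0.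
  by move=> DK Kt; rewrite /f (slice_cube0 DK Kt) measure0.
rewrite !intf//; apply: (@prekopa_leindler1 R K (fine (lebesgue_rV n (cube n K)))); auto.
move=> s t; rewrite -lee_fin expr2 !EFinM /f !fineK ?fin//.
apply: IH.
- exact: measurable_slice.
- exact: measurable_slice.
- exact: measurable_slice.
- exact: slice_cube.
- exact: slice_cube.
- exact: slice_cube.
by move=> x y Ax By; have := ABC _ _ Ax By; rewrite -rV_consD -rV_consZ [_^-1 * _]mulrC.
Qed.

Lemma measurable_scale n (a : R) :
  measurable_fun setT (fun x : 'rV[R]_n => a *: x).
Proof.
move=> _; apply: (@measurability _ _ _ _ setT (fun x : 'rV[R]_n => a *: x)
  (\big[setU/set0]_(i < n) preimage_set_system setT (@rV_coord R n i)
     measurable)) => //.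
move=> _ [B + <-]; rewrite -bigcup_seq => -[i _ [C mC <-]].
rewrite !setTI -comp_preimage -[_ @^-1` _]setTI.
suff /(_ measurableT _ mC) : measurable_fun setT (rV_coord i \o (fun x : 'rV[R]_n => a *: x)) by [].
rewrite (_ : _ \o _ = fun x : 'rV[R]_n => (a * rV_coord i x)).
  apply: (@measurable_funM _ _ _ setT (fun=> a) (rV_coord i)) => //.
  exact: measurable_rV_coord.
by apply/funext => x; rewrite /rV_coord/= mxE.
Qed.

Lemma lebesgue_scale n (a : R) (A : set 'rV[R]_n) : a != 0 -> measurable A ->
  lebesgue_rV n [set x | A (a *: x)] = ((`|a|^-1 ^+ n)%:E * lebesgue_rV n A)%E.
Proof.
move=> a0; elim: n A => [|n IH] A mA.
  rewrite /= expr0 mul1e !diracE; congr (_%:R%:E)%R; congr nat_of_bool.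
  by apply/idP/idP; rewrite !inE/= ?scaler0.
have mS m (D : set 'rV[R]_m) : measurable D -> measurable [set x | A (a *: x)].
  by move=> mD; rewrite -[X in measurable X]setTI; exact: measurable_scale.
rewrite !leb_slice//; last exact: (mS n.+1 A).
pose phi (t : measurableTypeR R) : \bar R := lebesgue_rV n (slice t A).
have mphi : measurable_fun setT phi by exact: measurable_leb_slice.
(* The summand 0 gives the substitution the shape of [measurable_affine] and
   [lebesgue_preimage_affine]. *)
transitivity (\int[L1]_t ((`|a|^-1 ^+ n)%:E * phi (a * t + 0)%R))%E.
  apply: eq_integral => t _; rewrite /phi -IH; last exact: measurable_slice.
  by rewrite addr0; congr (lebesgue_rV n _); apply/seteqP; split => y; rewrite /slice/= rV_consZ.
have c0 : 0 <= `|a|^-1 by rewrite invr_ge0.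
have ma := @measurable_affine R a 0.
rewrite ge0_integralZl//; last exact: (measurableT_comp mphi ma).
rewrite exprSr EFinM -muleA; congr (_ * _)%E.
transitivity (
  \int[pushforward L1 (fun x : measurableTypeR R => a * x + 0 : measurableTypeR R)%R]_t phi t)%E.
  by rewrite (ge0_integral_pushforward ma).
transitivity (\int[mscale (NngNum c0) L1]_t phi t)%E.
  by apply: eq_measure_integral => D mD _; exact: lebesgue_preimage_affine.
exact: ge0_integral_mscale.
Qed.

Lemma enorm_ge0 n (x : 'rV[R]_n) : 0 <= enorm x.
Proof. exact: sqrtr_ge0. Qed.

Lemma enormZ n a (x : 'rV[R]_n) : enorm (a *: x) = `|a| * enorm x.
Proof.
rewrite /enorm -sqrtr_sqr -sqrtrM ?sqr_ge0//; congr Num.sqrt.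
by rewrite mulr_sumr; apply: eq_bigr => i _; rewrite mxE exprMn.
Qed.

Lemma enorm_coord n (x : 'rV[R]_n) i : `|x 0 i| <= enorm x.
Proof.
rewrite /enorm -sqrtr_sqr ler_sqrt; last by rewrite sumr_ge0// => j _; rewrite sqr_ge0.
by rewrite (bigD1 i)//= lerDl sumr_ge0// => j _; rewrite sqr_ge0.
Qed.

Lemma eball_cube n (r : R) : eball 0 r `<=` cube n r.
Proof.
move=> x; rewrite /eball/= subr0 => xr i; apply/ltW.
exact: le_lt_trans (enorm_coord x i) xr.
Qed.

Lemma measurable_eball0 n (r : R) : measurable (eball (0 : 'rV[R]_n) r).
Proof.
have m : measurable_fun setT (fun x : 'rV[R]_n => enorm x).
  rewrite /enorm; apply: (measurableT_comp (f := @Num.sqrt R)).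
    by apply: continuous_measurable_fun; exact: sqrt_continuous.
  apply: measurable_sum => i; apply: (measurable_funX 2).
  exact: measurable_rV_coord.
rewrite (_ : eball _ _ = setT `&` (fun x : 'rV[R]_n => enorm x) @^-1` `]-oo, r[%classic).
  by apply: m => //; exact: measurable_itv.
by apply/seteqP; split => x; rewrite /eball/= subr0 in_itv/=; [|case].
Qed.

Lemma lebesgue_eball n (r : R) : 0 < r ->
  lebesgue_rV n (eball 0 r) = ((r ^+ n)%:E * unit_ball_volume n)%E.
Proof.
move=> r0; rewrite /unit_ball_volume -[X in (X ^+ _)%R]invrK.
rewrite -[in X in (X ^+ _)%R](@ger0_norm _ r^-1) ?invr_ge0 ?ltW//.
rewrite -lebesgue_scale ?invr_neq0 ?gt_eqF//; last exact: measurable_eball0.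
congr (lebesgue_rV n _); apply/seteqP; split => x; rewrite /eball/= !subr0 enormZ.
  by rewrite ger0_norm ?invr_ge0 ?ltW// mulrC ltr_pdivrMr// mul1r.
by rewrite ger0_norm ?invr_ge0 ?ltW// mulrC ltr_pdivrMr// mul1r.
Qed.

Lemma enorm_tail n (x : 'rV[R]_n.+1) : enorm (rV_tail x) <= enorm x.
Proof.
rewrite ler_sqrt; last by rewrite sumr_ge0// => j _; rewrite sqr_ge0.
rewrite big_ord_recl ler_wpDl ?sqr_ge0// ler_sum// => i _.
by rewrite mxE.
Qed.

Lemma unit_ball_volume_fin n : @unit_ball_volume R n \is a fin_num.
Proof.
apply: (@lebesgue_fin _ 1); last exact: eball_cube.
exact: measurable_eball0.
Qed.

(* Brunn-Minkowski for A and - A: (A - A) / 2 lies in the ball of radius d / 2. *)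
Theorem isodiametric n (d : R) (A : set 'rV[R]_n) : measurable A -> 0 <= d ->
  (forall x y, A x -> A y -> enorm (x - y) <= d) ->
  (lebesgue_rV n A <= unit_ball_volume n * ((d / 2) ^+ n)%:E)%E.
Proof.
move=> mA d0 Ad.
have w0 : 0 <= fine (@unit_ball_volume R n) by rewrite fine_ge0.
have [->|/set0P[a0 Aa0]] := eqVneq A set0.
  by rewrite measure0 mule_ge0// lee_fin exprn_ge0// divr_ge0.
(* One cube has to contain A, - A and all balls of radius below d / 2 + 1. *)
pose K := enorm a0 + d + 1.
have AK : A `<=` cube n K.
  move=> x Ax i; rewrite -[x](subrK a0) mxE (le_trans (ler_normD _ _))//.
  have := enorm_coord a0 i.
  by have := le_trans (enorm_coord (x - a0) i) (Ad _ _ Ax Aa0); rewrite /K; lra.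
have Afin := lebesgue_fin mA AK.
pose B := [set x : 'rV[R]_n | A (-1 *: x)].
have mB : measurable B by rewrite -[B]setTI; exact: measurable_scale.
have BA : lebesgue_rV n B = lebesgue_rV n A.
  by rewrite lebesgue_scale ?oppr_eq0 ?oner_eq0// normrN1 invr1 expr1n mul1e.
have BK : B `<=` cube n K.
  by move=> x /AK h i; have := h i; rewrite mxE mulN1r normrN.
(* Midpoints of A and - A lie in the closed ball of radius d / 2, while [eball] is open; hence the
   strictly larger radius r, which then tends to d / 2 by continuity of the power. *)
have ball_ge r : d / 2 < r -> r < d / 2 + 1 ->
    fine (lebesgue_rV n A) <= r ^+ n * fine (@unit_ball_volume R n).
  move=> dr rd; have r0 : 0 < r by rewrite (le_lt_trans _ dr)// divr_ge0.
  rewrite -lee_fin EFinM fineK// fineK ?unit_ball_volume_fin// -lebesgue_eball//.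
  have CK : eball 0 r `<=` cube n K.
    move=> x /eball_cube xr i; rewrite (le_trans (xr i))// (le_trans (ltW rd))// /K.
    by have := enorm_ge0 a0; lra.
  have mC := @measurable_eball0 n r.
  have Cfin := lebesgue_fin mC CK.
  have := brunn_minkowski mA mB mC AK BK CK; rewrite BA.
  rewrite -(fineK Afin) -(fineK Cfin) -!EFinM !lee_fin -!expr2 ler_sqr ?nnegrE ?fine_ge0//.
  apply => x y Ax By; rewrite /eball/= subr0 enormZ ger0_norm ?invr_ge0// mulrC.
  apply: le_lt_trans dr; rewrite ler_pM2r ?invr_gt0//.
  by have := Ad _ _ Ax By; rewrite scaleN1r opprK.
rewrite -(fineK Afin) -(fineK (@unit_ball_volume_fin n)) -EFinM lee_fin leNgt mulrC.
apply/negP => dA.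
pose f (r : R) : R := r ^+ n * fine (@unit_ball_volume R n).
have cf : f x @[x --> d / 2] --> f (d / 2).
  by apply: cvgM; [exact: exprn_continuous|exact: cvg_cst].
have /nbhs_ballP[e /= e0 he] : nbhs (d / 2) [set r | f r < fine (lebesgue_rV n A)].
  exact: (cvgr_lt (f (d / 2)) cf).
pose m := Num.min (e / 2) (1 / 2).
have m0 : 0 < m by rewrite lt_min !divr_gt0.
have me : m < e by rewrite gt_min; apply/orP; left; rewrite ltr_pdivrMr// mulr_natr mulr2n ltrDl.
have m1 : m < 1 by rewrite gt_min; apply/orP; right; lra.
have : f (d / 2 + m) < fine (lebesgue_rV n A).
  by apply: he; rewrite /ball/= opprD addrA subrr add0r normrN gtr0_norm.
by rewrite ltNge => /negP; apply; apply: ball_ge; lra.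
Qed.

End isodiametric.

(** * Hausdorff measure and projections *)

Section borel_rV.
Context {R : realType}.

Lemma normr_coord n (x : 'rV[R]_n) i : `|x 0 i| <= `|x|.
Proof.
have -> : `|x| = mx_norm x by [].
rewrite mx_normrE; apply/bigmax_geP; right => /=.
by exists (0, i).
Qed.

Lemma normr_le_coord n (x : 'rV[R]_n) b : 0 <= b -> (forall i, `|x 0 i| <= b) -> `|x| <= b.
Proof.
move=> b0 xb.
have -> : `|x| = mx_norm x by [].
rewrite mx_normrE; apply/bigmax_leP; split => // -[i j] _ /=.
by rewrite (ord1 i).
Qed.

Lemma normr_enorm n (x : 'rV[R]_n) : `|x| <= enorm x.
Proof. by apply: normr_le_coord; [exact: enorm_ge0|exact: enorm_coord]. Qed.

Lemma enorm_le n (x : 'rV[R]_n) : enorm x <= n%:R * `|x|.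
Proof.
rewrite -[leRHS]ger0_norm ?mulr_ge0// -sqrtr_sqr ler_sqrt ?sqr_ge0//.
apply: (@le_trans _ _ (\sum_(i < n) `|x| ^+ 2)).
  apply: ler_sum => i _; rewrite -[leLHS]real_normK ?num_real// ler_sqr ?nnegrE//.
  exact: normr_coord.
rewrite sumr_const card_ord exprMn -[leLHS]mulr_natl ler_wpM2r ?sqr_ge0// -natrX ler_nat.
by case: n {x} => // n; rewrite -mulnn leq_pmulr.
Qed.

Lemma ball_rV n (x y : 'rV[R]_n) e : ball x e y <-> `|x - y| < e.
Proof. by rewrite mx_norm_ball. Qed.

(** The sigma-algebra is generated by the coordinates, so U is written as the countable union of the
    boxes with rational centre and half-width 1 / (k + 1) that it contains. *)
Lemma open_measurable_rV n (U : set 'rV[R]_n) : open U -> measurable U.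
Proof.
move=> oU.
pose Q (p : 'rV[rat]_n * nat) : set 'rV[R]_n :=
  \bigcap_(i in [set: 'I_n]) (rV_coord i @^-1`
    `[ratr (p.1 0 i) - p.2.+1%:R^-1, ratr (p.1 0 i) + p.2.+1%:R^-1]%classic).
have mQ p : measurable (Q p).
  apply: fin_bigcap_measurable => // i _.
  by rewrite -[_ @^-1` _]setTI; exact: measurable_rV_coord.
rewrite (_ : U = \bigcup_p (if `[< Q p `<=` U >] then Q p else set0)).
  apply: countable_bigcupT_measurable; first exact: countableP.
  by move=> p; case: ifPn.
apply/seteqP; split => [x Ux|x [p _]]; last by case: ifPn => // /asboolP; exact.
have /nbhs_ballP[e /= e0 he] : nbhs x U by exact: open_nbhs_nbhs.
have [k ke] : exists k : nat, k.+1%:R^-1 < e / 2.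
  have := @ltr_add_invr R 0 (e / 2); rewrite divr_gt0// => /(_ isT)[k].
  by rewrite add0r => ?; exists k.
have k0 : 0 < k.+1%:R^-1 :> R by rewrite invr_gt0.
have rx i : exists q : rat, `|x 0 i - ratr q| <= k.+1%:R^-1.
  have xk : x 0 i < x 0 i + k.+1%:R^-1 by rewrite ltrDl.
  have [q] := rat_in_itvoo xk; rewrite in_itv/= => /andP[q1 q2].
  by exists q; rewrite ltW// distrC gtr0_norm ?subr_gt0// ltrBlDl.
have [q hq] := choice rx.
exists (\row_i q i, k) => //.
have qU : Q (\row_i q i, k) `<=` U.
  move=> y Qy; apply: he; apply/ball_rV.
  apply: (@le_lt_trans _ _ (k.+1%:R^-1 + k.+1%:R^-1)); last by rewrite [ltRHS](splitr e) ltrD.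
  apply: normr_le_coord; first by rewrite addr_ge0// ltW.
  move=> i; rewrite !mxE; have := Qy i I; rewrite /= in_itv/= /rV_coord mxE.
  rewrite -lter_distl => hy.
  rewrite -(subrKA (ratr (q i))); apply: le_trans (ler_normD _ _) _.
  by apply: lerD; [exact: hq|rewrite distrC].
case: ifPn => [_ i _|/asboolP//].
by rewrite /= in_itv/= mxE /rV_coord -lter_distl; exact: hq.
Qed.

Lemma closed_measurable_rV n (U : set 'rV[R]_n) : closed U -> measurable U.
Proof.
by move=> cU; rewrite -[U]setCK; apply: measurableC; apply: open_measurable_rV; exact: closed_openC.
Qed.

Lemma continuous_measurable_rV n (f : 'rV[R]_n -> R) : continuous f -> measurable_fun setT f.
Proof.
move=> cf; apply: (measurability _ (RGenOpens.measurableE R)) => //.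
move=> _ [_ [a [b ->] <-]]; rewrite setTI; apply: open_measurable_rV.
by apply: open_comp => [x _|]; [exact: cf|exact: interval_open].
Qed.

Lemma enorm_continuous n (z : 'rV[R]_n) : continuous (fun x : 'rV[R]_n => enorm (x - z)).
Proof.
have cS : continuous (fun x : 'rV[R]_n => \sum_(i < n) (x - z) 0 i ^+ 2).
  apply: continuous_big => [|i _ x]; first exact: add_continuous.
  have -> : (fun x : 'rV[R]_n => (x - z) 0 i ^+ 2) =
      (fun x : 'rV[R]_n => (x 0 i - z 0 i) * (x 0 i - z 0 i)).
    by apply/funext => y; rewrite !mxE expr2.
  have c1 : {for x, continuous (fun y : 'rV[R]_n => y 0 i - z 0 i)}.
    by apply: continuousB; [exact: coord_continuous|exact: cst_continuous].
  exact: (continuousM c1 c1).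
by move=> x; apply: (continuous_comp (cS x)); exact: sqrt_continuous.
Qed.

Lemma boundary_closed n (Omega : set 'rV[R]_n) : closed (boundary Omega).
Proof.
rewrite /boundary setDE; apply: closedI; first exact: closed_closure.
by apply: open_closedC; exact: open_interior.
Qed.

End borel_rV.

Section hausdorff_projection.
Context {R : realType}.

(* E is the set of points at distance <= d from every point that is itself at
   distance <= d from all of C; being closed, it is measurable. *)
Lemma bounded_diam_cover n (d : R) (C : set 'rV[R]_n) :
  (forall x y, C x -> C y -> enorm (x - y) <= d) ->
  exists E, [/\ measurable E, C `<=` E & forall x y, E x -> E y -> enorm (x - y) <= d].
Proof.
move=> Cd.
pose H (D : set 'rV[R]_n) := [set y | forall z, D z -> enorm (y - z) <= d].
have enormB (x y : 'rV[R]_n) : enorm (x - y) = enorm (y - x).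
  by rewrite -opprB -scaleN1r enormZ normrN1 mul1r.
have mH D : measurable (H D).
  apply: closed_measurable_rV.
  rewrite (_ : H D = \bigcap_(z in D) ((fun y => enorm (y - z)) @^-1` [set r | r <= d])).
    apply: closed_bigI => z _; apply: preimage_closed; last exact: closed_le.
    by move=> y _; exact: enorm_continuous.
  by apply/seteqP; split => y.
exists (H (H C)); split => //.
  by move=> x Cx z /(_ x Cx); rewrite enormB.
move=> x y Hx Hy; apply: Hx => z Cz; apply: Hy => w Cw; exact: Cd.
Qed.

(** The covers in the Hausdorff measure use arbitrary sets, whose projections need not be
    measurable; the hull E has the same diameter bound, so the isodiametric inequality applies to
    it. When C has diameter above 1 its gauge is +oo and E is the whole space. *)
Lemma lebesgue_le_gauge n (C : set 'rV[R]_n.+1) : exists E : set 'rV[R]_n,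
  [/\ measurable E, [set rV_tail x | x in C] `<=` E &
      (lebesgue_rV n E <= hausdorff_gauge n 1 C)%E].
Proof.
rewrite /hausdorff_gauge; case: ifPn => [/eqP ->|C0].
  by exists set0; split => //; [move=> _ [x []]|rewrite measure0].
case: ifPn => [dC|_]; last by exists setT; split => //; rewrite leey.
have d0 := diam_ge0 C0.
have dfin : diam C \is a fin_num by rewrite ge0_fin_numE// (le_lt_trans dC)// ltry.
have Cd x y : C x -> C y -> enorm (x - y) <= fine (diam C).
  move=> Cx Cy; rewrite -lee_fin fineK//.
  by apply: ereal_sup_ubound; exists x, y.
have [|E [mE CE Ed]] := @bounded_diam_cover n (fine (diam C)) [set rV_tail x | x in C].
  move=> _ _ [x Cx <-] [y Cy <-]; apply: le_trans (Cd _ _ Cx Cy).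
  rewrite (_ : _ - _ = rV_tail (x - y)); first exact: enorm_tail.
  by apply/rowP => i; rewrite !mxE.
exists E; split => //.
apply: le_trans (isodiametric mE (fine_ge0 d0) Ed) _.
rewrite -[in leRHS](fineK dfin) EFin_expe EFinM.
by rewrite inver pnatr_eq0.
Qed.

Theorem lebesgue_le_hausdorff n (V : set 'rV[R]_n) (S : set 'rV[R]_n.+1) :
  measurable V -> V `<=` [set rV_tail x | x in S] ->
  (lebesgue_rV n V <= hausdorff n S)%E.
Proof.
(* The isodiametric bound does not depend on the scale of the cover, so the fixed scale 1
   suffices. *)
move=> mV VS; apply: (@le_trans _ _ (hausdorff_pre n 1 S)); last first.
  by apply: ereal_sup_ubound; exists 1 => //=.
apply: le_ereal_inf_tmp => _ [C [_ SC] <-].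
have [E hE] := choice (@lebesgue_le_gauge n).
apply: (@le_trans _ _ (\sum_(k <oo) lebesgue_rV n (E (C k)))%E).
  apply: measure_sigma_subadditive => //.
    by move=> k; have [] := hE (C k).
  move=> y /VS[x /SC[k _ Ckx] <-]; exists k => //.
  by have [_ h _] := hE (C k); apply: h; exists x.
apply: lee_nneseries => // k _; have [_ _] := hE (C k); exact.
Qed.

End hausdorff_projection.

(** * Caratheodory measurability of closed sets *)

Section metric_outer_measure.
Context {R : realType} {n : nat}.
Variable mu : {outer_measure set 'rV[R]_n -> \bar R}.
Hypothesis mu_metric : forall (A B : set 'rV[R]_n) (eta : R), 0 < eta ->
  (forall a b, A a -> B b -> eta <= `|a - b|) -> (mu A + mu B <= mu (A `|` B))%E.

(** This is Caratheodory's criterion. [A m] is the part of X at distance at least 1 / (m + 1) from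
    K, so it is separated from K, and the shells [D i] with i >= m cover the rest of X outside K.
    Shells of equal parity are mutually separated, which bounds their total mass by twice that of X;
    the tail of the series therefore vanishes. *)
Theorem closed_caratheodory (K : set 'rV[R]_n) : closed K -> mu.-caratheodory K.
Proof.
move=> cK; apply: le_caratheodory_measurable => X.
have [->|Xoo] := eqVneq (mu X) +oo%E; first by rewrite leey.
have muX : (mu X < +oo)%E by rewrite ltey.
pose A m := X `&` [set x | forall z, K z -> m.+1%:R^-1 <= `|x - z|].
pose D m := A m.+1 `\` A m.
have inv_gt0 m : 0 < m.+1%:R^-1 :> R by rewrite invr_gt0.
have AX m : A m `<=` X by move=> x [].
have AS m : A m `<=` A m.+1.
  move=> x [Xx Ax]; split => // z /Ax; apply: le_trans.
  by rewrite lef_pV2 ?posrE// ler_nat.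
have sepK m : (mu (X `&` K) + mu (A m) <= mu X)%E.
  apply: le_trans (_ : (mu (X `&` K `|` A m) <= _)%E).
    apply: (mu_metric (inv_gt0 m)) => a b [_ Ka] [_ /(_ a Ka)].
    by rewrite distrC.
  by apply: le_outer_measure => x [[]//|/AX].
have sepD m : (mu (A m) + mu (D m.+1) <= mu (A m.+2))%E.
  apply: le_trans (_ : (mu (A m `|` D m.+1) <= _)%E); last first.
    by apply: le_outer_measure => x [/AS/AS|[]].
  have eta0 : 0 < m.+1%:R^-1 - m.+2%:R^-1 :> R.
    by rewrite subr_gt0 ltf_pV2 ?posrE// ltr_nat.
  (* Since b is outside [A m.+1], some z in K is within 1 / (m + 2) of b, whereas a stays at least 1
     / (m + 1) away from z. *)
  apply: (mu_metric eta0) => a b [Xa Aa] [[Xb _]] nAb.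
  have [z [Kz bz]] : exists z, K z /\ `|b - z| < m.+2%:R^-1.
    apply: contrapT => H; apply: nAb; split => // z Kz.
    by rewrite leNgt; apply/negP => bz; apply: H; exists z.
  rewrite lerBlDr; apply: (le_trans (Aa z Kz)).
  rewrite -(subrKA b); apply: (le_trans (ler_normD _ _)).
  by rewrite lerD2l ltW.
(* D m.+1 is at positive distance from A m, which makes each step of the
   induction additive. *)
have sumD m : (\sum_(0 <= i < m) mu (D i) <= mu (A m) + mu (A m.-1))%E.
  elim: m => [|m IH]; first by rewrite big_geq// adde_ge0// outer_measure_ge0.
  rewrite big_nat_recr//=; case: m IH => [_|m IH].
    rewrite big_geq// add0e -[leLHS]adde0 leeD// ?outer_measure_ge0//.
    by apply: le_outer_measure => x [].
  apply: (le_trans (leeD2r _ IH)); rewrite -addeA addeC.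
  by apply: leeD => //; exact: sepD.
have sumoo : (\sum_(0 <= i <oo) mu (D i) < +oo)%E.
  apply: (@le_lt_trans _ _ (mu X + mu X)%E); last by rewrite lte_add_pinfty.
  apply: lime_le; first by apply: is_cvg_nneseries => *; exact: outer_measure_ge0.
  apply: nearW => m; apply: (le_trans (sumD m)).
  by apply: leeD; apply: le_outer_measure; exact: AX.
have cover m : X `&` ~` K `<=` A m `|` \bigcup_(i in ~` `I_m) D i.
  move=> x [Xx nKx].
  have [k Akx] : exists k, A k x.
    have : nbhs x (~` K) by apply: open_nbhs_nbhs; split => //; exact: closed_openC.
    move=> /nbhs_ballP[e /= e0 he].
    have := @ltr_add_invr R 0 e e0 => -[k]; rewrite add0r => ke.
    exists k; split => // z Kz; rewrite leNgt; apply/negP => xz.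
    by apply: (he z _ Kz); apply/ball_rV; exact: lt_trans xz ke.
  elim: k Akx => [|k IH] Akx.
    by left; elim: m => // m IHm; exact: AS.
  have [/IH//|nAk] := pselect (A k x).
  have [mk|km] := leqP m k; first by right; exists k => //; apply/negP; rewrite -leqNgt.
  left; rewrite -(subnK km); elim: (m - k.+1)%N => // j; rewrite addSn; exact: AS.
have tail m : (mu (X `&` ~` K) <= mu (A m) + \sum_(m <= i <oo) mu (D i))%E.
  apply: le_trans (le_outer_measure mu _ _ (cover m)) _.
  apply: le_trans (outer_measureU2 _ _ _) _; rewrite leeD2l//.
  exact: outer_measure_sigma_subadditive_tail.
apply/lee_addgt0Pr => e e0.
have := nneseries_tail_cvg sumoo (fun k _ => outer_measure_ge0 mu (D k)).
move=> /fine_cvgP[fN cN].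
have [m [fm hm]] : exists m, (\sum_(m <= i <oo) mu (D i))%E \is a fin_num /\
    fine (\sum_(m <= i <oo) mu (D i))%E < e.
  have ltN : \forall m \near \oo, fine (\sum_(m <= i <oo) mu (D i))%E < e.
    exact: (cvgr_lt 0 cN).
  have [m0 _ hm0] := filterI fN ltN.
  by exists m0; apply: hm0 => /=.
apply: le_trans (leeD2l _ (tail m)) _; rewrite addeA; apply: leeD; first exact: sepK.
by rewrite -(fineK fm) lee_fin ltW.
Qed.

End metric_outer_measure.

(** * Hausdorff measure as a metric outer measure *)

Section hausdorff_metric.
Context {R : realType} {n : nat}.
Variable k : nat.
Implicit Types A B C : set 'rV[R]_n.

Lemma hausdorff_gauge_mono (d1 d2 : R) C : d1 <= d2 ->
  (hausdorff_gauge k d2 C <= hausdorff_gauge k d1 C)%E.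
Proof.
move=> d12; rewrite /hausdorff_gauge; case: ifPn => // C0.
case: (leP (diam C) d1%:E) => [Cd|]; last by rewrite leey.
by rewrite (le_trans Cd) ?lee_fin.
Qed.

Lemma hausdorff_pre_mono (d1 d2 : R) A : d1 <= d2 ->
  (hausdorff_pre k d2 A <= hausdorff_pre k d1 A)%E.
Proof.
move=> d12; apply: le_ereal_inf_tmp => _ [C [mC AC] <-].
apply: (@le_trans _ _ (\sum_(i <oo) hausdorff_gauge k d2 (C i))%E).
  by apply: ereal_inf_lbound; exists C.
by apply: lee_nneseries => *; [exact: hausdorff_gauge_ge0|exact: hausdorff_gauge_mono].
Qed.

(** A set of the cover that meets both A and B has diameter at least eta > d, hence gauge +oo.
    Otherwise each set serves only one of them, and the cover splits through [meet]. *)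
Lemma hausdorff_pre_metric (d eta : R) A B : d < eta ->
  (forall a b, A a -> B b -> eta <= `|a - b|) ->
  (hausdorff_pre k d A + hausdorff_pre k d B <= hausdorff_pre k d (A `|` B))%E.
Proof.
move=> deta AB; apply: le_ereal_inf_tmp => _ [C [mC ABC] <-].
pose meet (D : set 'rV[R]_n) (E : set 'rV[R]_n) : set 'rV[R]_n :=
  if `[< E `&` D !=set0 >] then E else set0.
have cov D : D `<=` A `|` B ->
    (hausdorff_pre k d D <= \sum_(i <oo) hausdorff_gauge k d (meet D (C i)))%E.
  move=> DAB; apply: ereal_inf_lbound; exists (fun i => meet D (C i)) => //; split => //.
  move=> x Dx; have [i _ Cix] := ABC x (DAB x Dx); exists i => //.
  by rewrite /meet; case: ifPn => // /asboolP; case; exists x.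
apply: le_trans (leeD (cov A _) (cov B _)) _; [by left|by right|].
rewrite -nneseriesD; try by move=> *; exact: hausdorff_gauge_ge0.
apply: lee_nneseries; first by move=> *; rewrite adde_ge0// hausdorff_gauge_ge0.
move=> i _; rewrite /meet.
case: ifPn => [/asboolP[a [Ca Aa]]|_]; last first.
  rewrite hausdorff_gauge0 add0e; case: ifPn => // _; rewrite hausdorff_gauge0.
  exact: hausdorff_gauge_ge0.
case: ifPn => [/asboolP[b [Cb Bb]]|_]; last by rewrite hausdorff_gauge0 adde0.
rewrite [leRHS](_ : _ = +oo%E) ?leey//.
rewrite /hausdorff_gauge; case: ifPn => [/eqP C0|_]; first by rewrite C0 in Ca.
rewrite leNgt ifN// negbK; apply: (@lt_le_trans _ _ eta%:E); first by rewrite lte_fin.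
apply: (@le_trans _ _ (enorm (a - b))%:E).
  by rewrite lee_fin (le_trans (AB _ _ Aa Bb))// normr_enorm.
by apply: ereal_sup_ubound; exists a, b.
Qed.

Lemma hausdorff_metric (A B : set 'rV[R]_n) (eta : R) : 0 < eta ->
  (forall a b, A a -> B b -> eta <= `|a - b|) ->
  (hausdorff k A + hausdorff k B <= hausdorff k (A `|` B))%E.
Proof.
move=> eta0 AB.
have pre_ge0 (d : R) (D : set 'rV[R]_n) : (0 <= hausdorff_pre k d D)%E.
  by apply: mu_ext_ge0; exact: hausdorff_gauge_ge0.
have pre_le (d : R) (D : set 'rV[R]_n) : 0 < d -> (hausdorff_pre k d D <= hausdorff k D)%E.
  by move=> d0; apply: ereal_sup_ubound; exists d.
have key (dA dB : R) : 0 < dA -> 0 < dB ->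
    (hausdorff_pre k dA A + hausdorff_pre k dB B <= hausdorff k (A `|` B))%E.
  move=> dA0 dB0; pose d := Num.min (eta / 2) (Num.min dA dB).
  have d0 : 0 < d by rewrite !lt_min dA0 dB0 divr_gt0.
  have deta : d < eta.
    by rewrite gt_min ltr_pdivrMr// mulr_natr mulr2n ltrDl eta0.
  apply: le_trans (pre_le d _ d0); apply: le_trans (hausdorff_pre_metric deta AB).
  by apply: leeD; apply: hausdorff_pre_mono; rewrite !ge_min lexx ?orbT.
(* The suprema over dA and dB are taken one after the other by subtraction, which requires finite
   values. *)
have [->|/eqP Hoo] := eqVneq (hausdorff k (A `|` B)) +oo%E; first by rewrite leey.
have Hfin : hausdorff k (A `|` B) \is a fin_num.
  by rewrite ge0_fin_numE ?outer_measure_ge0// ltey; apply/eqP.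
have preB dB : 0 < dB -> hausdorff_pre k dB B \is a fin_num.
  move=> dB0; rewrite ge0_fin_numE//; apply: (@le_lt_trans _ _ (hausdorff k (A `|` B))).
    by apply: le_trans (key 1 dB ltr01 dB0); rewrite leeDr.
  by rewrite ltey; apply/eqP.
have HA dB : 0 < dB -> (hausdorff k A <= hausdorff k (A `|` B) - hausdorff_pre k dB B)%E.
  move=> dB0; apply: ge_ereal_sup => _ [dA /= dA0 <-].
  by rewrite leeBrDr ?preB//; exact: key.
have HAfin : hausdorff k A \is a fin_num.
  rewrite ge0_fin_numE ?outer_measure_ge0//; apply: le_lt_trans (HA 1 ltr01) _.
  have : (hausdorff k (A `|` B) - hausdorff_pre k 1 B)%E \is a fin_num.
    by rewrite fin_numB Hfin preB.
  by rewrite fin_numElt => /andP[].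
rewrite addeC -leeBrDr//; apply: ge_ereal_sup => _ [dB /= dB0 <-].
by rewrite leeBrDr// addeC -leeBrDr ?preB//; exact: HA.
Qed.

End hausdorff_metric.

(** * Divergence theorem on a half-space *)

Section fubini_rV.
Context {R : realType}.
Local Notation L1 := (@lebesgue_measure R).

Lemma fubini_rV n (f : 'rV[R]_n.+1 -> R) :
  (lebesgue_rV n.+1).-integrable setT (EFin \o f) ->
  (\int[lebesgue_rV n.+1]_x (f x)%:E =
     \int[L1]_t \int[lebesgue_rV n]_y (f (rV_cons (t, y)))%:E)%E /\
  (\int[lebesgue_rV n.+1]_x (f x)%:E =
     \int[lebesgue_rV n]_y \int[L1]_t (f (rV_cons (t, y)))%:E)%E.
Proof.
move=> intf.
have mf : measurable_fun setT (EFin \o f) by apply: (measurable_int _ intf).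
have mc := @measurable_rV_cons R n.
pose m12 : {measure set (measurableTypeR R * 'rV[R]_n) -> \bar R} := (L1 \x (@leb R n))%E.
pose m21 : {measure set (measurableTypeR R * 'rV[R]_n) -> \bar R} := (L1 \x^ (@leb R n))%E.
have m1221 A : measurable A -> m12 A = m21 A.
  by move=> mA; apply: (product_measure_unique) => // X Y mX mY; exact: product_measure2E.
have tr (g : 'rV[R]_n.+1 -> \bar R) : measurable_fun setT g -> (forall x, 0 <= g x)%E ->
    (\int[lebesgue_rV n.+1]_x g x = \int[m12]_p (g \o @rV_cons R n) p)%E.
  move=> mg g0; transitivity (\int[pushforward m12 (@rV_cons R n)]_x g x)%E.
    apply: eq_measure_integral => A mA _; apply/esym/m1221.
    by rewrite -[X in measurable X]setTI; exact: mc.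
  by rewrite (ge0_integral_pushforward mc)// preimage_setT.
have intg : m12.-integrable setT ((EFin \o f) \o @rV_cons R n).
  apply/integrableP; split; first exact: measurableT_comp.
  move/integrableP : intf => [_]; rewrite tr//.
  by apply: measurableT_comp.
have E : (\int[lebesgue_rV n.+1]_x (f x)%:E = \int[m12]_p (f (@rV_cons R n p))%:E)%E.
  transitivity (\int[pushforward m12 (@rV_cons R n)]_x (f x)%:E)%E.
    apply: eq_measure_integral => A mA _; apply/esym/m1221.
    by rewrite -[X in measurable X]setTI; exact: mc.
  by rewrite (integral_pushforward mc mf)// preimage_setT.
rewrite E; split.
  by rewrite -(@integral12_prod_meas1 _ _ _ _ _ L1 (@leb R n)).
by rewrite -(@integral21_prod_meas1 _ _ _ _ _ L1 (@leb R n)).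
Qed.

Lemma integrable_bounded_cube n (f : 'rV[R]_n -> R) (K M : R) :
  measurable_fun setT f -> (forall x, `|f x| <= M) ->
  (forall x, ~ cube n K x -> f x = 0) ->
  (lebesgue_rV n).-integrable setT (EFin \o f).
Proof.
move=> mf fM fK; apply/integrableP; split; first exact/measurable_EFinP.
have mc := @measurable_cube R n K.
apply: (@le_lt_trans _ _ (\int[lebesgue_rV n]_x (M%:E * (\1_(cube n K) x)%:E))%E).
  apply: ge0_le_integral => //.
  - by apply: measurableT_comp => //; exact/measurable_EFinP.
  - by apply: measurable_funeM; apply/measurable_EFinP; exact: measurable_indic.
  move=> x _ /=; rewrite -EFinM lee_fin indicE.
  have [xK|xK] := pselect (cube n K x); first by rewrite mem_set// mulr1.
  by rewrite fK// normr0 memNset// mulr0.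
have M0 : 0 <= M by apply: le_trans (fM 0).
rewrite ge0_integralZl//; last by apply/measurable_EFinP; exact: measurable_indic.
rewrite integral_indic// setIT lte_mul_pinfty//.
exact: lebesgue_cube_lty.
Qed.

Lemma continuous_bounded_cube n (f : 'rV[R]_n -> R) (K : R) : continuous f ->
  (forall x, ~ cube n K x -> f x = 0) -> exists M, forall x, `|f x| <= M.
Proof.
move=> cf fK.
have cK : compact (cube n K).
  have := @rV_compact _ n (fun=> `[- K, K]%classic) (fun=> @segment_compact R (- K) K).
  congr compact; apply/seteqP; split => x h i; have := h i.
    by rewrite /= in_itv/= -ler_norml.
  by rewrite /= in_itv/= -ler_norml.
have [M [_ hM]] := compact_bounded (continuous_compact (continuous_subspaceT cf) cK).
exists (Num.max 0 (M + 1)) => x; rewrite le_max; have [xK|/fK ->] := pselect (cube n K x).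
  by apply/orP; right; apply: (hM (M + 1)); [rewrite ltrDl|exists x].
by rewrite normr0 lexx.
Qed.

End fubini_rV.

Section divergence_theorem.
Context {R : realType}.
Local Notation L1 := (@lebesgue_measure R).

(** phi carries the line through a along v to the line through phi a along w, so the two difference
    quotients are the same function of h. *)
Lemma is_derive_comp_affine (V W : normedModType R) (phi : V -> W) (f : W -> R)
    (a v : V) (w : W) (d : R) :
  (forall h : R, phi (h *: v + a) = h *: w + phi a) ->
  is_derive (phi a) w f d -> is_derive a v (f \o phi) d.
Proof.
move=> phiE [fw fd].
have E : (fun h : R => h^-1 *: (((f \o phi) \o shift a) (h *: v) - (f \o phi) a)) =
    (fun h : R => h^-1 *: ((f \o shift (phi a)) (h *: w) - f (phi a))).
  by apply/funext => h /=; rewrite phiE.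
by split; [rewrite /derivable E|rewrite /derive E].
Qed.

Lemma FTC_ray (F d : R -> R) (c K : R) : continuous d ->
  (forall x : R, is_derive x (1 : R) F (d x)) -> (forall x, K < `|x| -> F x = 0) ->
  (forall x, K < `|x| -> d x = 0) ->
  (\int[L1]_x ((c <= x)%R%:R * d x)%:E = (- F c)%:E)%E.
Proof.
(* b lies beyond both c and the support, so F b = 0 and the ray can be cut at b. *)
move=> cd dF F0 d0; pose b := Num.max c (Num.max 0 K) + 1.
have cb : c < b by rewrite ltr_pwDr// le_max lexx.
have Kb : K < b by rewrite ltr_pwDr// !le_max lexx !orbT.
have b0 : 0 < b by rewrite ltr_pwDr// !le_max lexx !orbT.
transitivity (\int[L1]_(x in `[c, b]) (d x)%:E)%E.
  rewrite [RHS]integral_mkcond; apply: eq_integral => x _; rewrite patchE.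
  have [cx|cx] := leP c x; last first.
    by rewrite mul0r memNset//= in_itv/= leNgt cx.
  have [xb|xb] := leP x b; first by rewrite mem_set/= ?in_itv/= ?cx// mul1r.
  rewrite memNset/=; last by rewrite in_itv/= [x <= b]leNgt xb andbF.
  by rewrite d0 ?mulr0// (lt_le_trans (lt_trans Kb xb))// ler_norm.
have cF : continuous F.
  move=> x; apply: differentiable_continuous; apply/derivable1_diffP.
  by have [] := dF x.
rewrite (@continuous_FTC2 R d F c b)//.
- by rewrite (F0 b) ?sub0e// (lt_le_trans Kb)// ler_norm.
- exact: continuous_subspaceT.
- split; first by move=> x _; have [] := dF x.
  + by apply: cvg_at_right_filter; exact: cF.
  + by apply: cvg_at_left_filter; exact: cF.
- by move=> x _; rewrite derive1E; have [] := dF x.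
Qed.

Lemma dist_le_continuous (V W : normedModType R) (f : V -> W) :
  (forall x y, `|f x - f y| <= `|x - y|) -> continuous f.
Proof.
move=> fd x; apply/cvgrPdist_lt => e e0; near=> y.
apply: le_lt_trans (fd _ _) _; near: y; exact: cvgr_dist_lt.
Unshelve. all: by end_near. Qed.

Lemma rV_consB n (s t : R) (x y : 'rV[R]_n) :
  rV_cons (s, x) - rV_cons (t, y) = rV_cons (s - t, x - y).
Proof. by rewrite rV_consD -[- t]mulN1r -[- y]scaleN1r rV_consZ scaleN1r. Qed.

Lemma normr_rV_cons n (t b : R) (y : 'rV[R]_n) :
  `|t| <= b -> `|y| <= b -> `|rV_cons (t, y)| <= b.
Proof.
move=> tb yb; apply: normr_le_coord => [|i]; first exact: le_trans tb.
case: (unliftP ord0 i) => [j|] ->; rewrite ?rV_cons_0// rV_cons_lift.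
exact: le_trans (normr_coord y j) yb.
Qed.

Lemma rV_cons_continuousl n (y : 'rV[R]_n) : continuous (fun t : R => rV_cons (t, y)).
Proof.
apply: dist_le_continuous => s t.
by rewrite rV_consB subrr normr_rV_cons// normr0.
Qed.

Lemma rV_cons_continuousr n (t : R) : continuous (fun y : 'rV[R]_n => rV_cons (t, y)).
Proof.
apply: dist_le_continuous => y z.
by rewrite rV_consB subrr normr_rV_cons// normr0.
Qed.

Lemma rV_cons_delta_lift n (t h : R) (y : 'rV[R]_n) (j : 'I_n) :
  rV_cons (t, h *: delta_mx 0 j + y) = h *: delta_mx 0 (lift ord0 j) + rV_cons (t, y).
Proof.
rewrite -[X in rV_cons (X, _)]add0r rV_consD; congr (_ + _).
rewrite -[0](mulr0 h) rV_consZ; congr (_ *: _); apply/rowP => i.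
rewrite [RHS]mxE; case: (unliftP ord0 i) => [k|] ->; last by rewrite rV_cons_0.
by rewrite rV_cons_lift mxE (inj_eq lift_inj).
Qed.

Lemma rV_cons_delta0 n (t h : R) (y : 'rV[R]_n) :
  rV_cons (h *: 1 + t, y) = h *: delta_mx 0 ord0 + rV_cons (t, y).
Proof.
rewrite -[X in rV_cons (_, X)]add0r rV_consD; congr (_ + _).
rewrite -[X in rV_cons (_, X)](scaler0 _ h) rV_consZ; congr (_ *: _); apply/rowP => i.
rewrite [RHS]mxE; case: (unliftP ord0 i) => [k|] ->; last by rewrite rV_cons_0.
by rewrite rV_cons_lift mxE.
Qed.

Lemma cube_rV_consl n (K t : R) (y : 'rV[R]_n) : K < `|t| -> ~ cube n.+1 K (rV_cons (t, y)).
Proof. by move=> Kt /(_ ord0); rewrite rV_cons_0 leNgt Kt. Qed.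

Lemma cube_rV_consr n (K t : R) (y : 'rV[R]_n) : ~ cube n K y -> ~ cube n.+1 K (rV_cons (t, y)).
Proof. by move=> yK h; apply: yK => i; have := h (lift ord0 i); rewrite rV_cons_lift. Qed.

Section compact_support.
Variables (n : nat) (f D : 'rV[R]_n -> R) (i : 'I_n) (K : R).

(** The derivative is carried as an explicit function D, and f and D both vanish off a cube, so that
    fixing the first coordinate yields data of the same kind in one dimension less. *)
Definition partial_derivative_cube : Prop := [/\ continuous D,
  forall x, is_derive x (delta_mx 0 i : 'rV[R]_n) f (D x),
  forall x, ~ cube n K x -> f x = 0 & forall x, ~ cube n K x -> D x = 0].

End compact_support.

Lemma partial_derivative_consr n (f D : 'rV[R]_n.+1 -> R) (j : 'I_n) K t :
  partial_derivative_cube f D (lift ord0 j) K ->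
  partial_derivative_cube (fun y => f (rV_cons (t, y))) (fun y => D (rV_cons (t, y))) j K.
Proof.
move=> [cD dD f0 D0]; split.
- by move=> y; apply: continuous_comp; [exact: rV_cons_continuousr|exact: cD].
- move=> y; apply: (@is_derive_comp_affine _ _ (fun y => rV_cons (t, y)) f) => //.
  by move=> h; exact: rV_cons_delta_lift.
- by move=> y yK; apply/f0/cube_rV_consr.
- by move=> y yK; apply/D0/cube_rV_consr.
Qed.

Lemma FTC_ray_rV n (f D : 'rV[R]_n.+1 -> R) K c y :
  partial_derivative_cube f D ord0 K ->
  (\int[L1]_t ((c <= t)%R%:R * D (rV_cons (t, y)))%:E = (- f (rV_cons (c, y)))%:E)%E.
Proof.
move=> [cD dD f0 D0].
apply: (@FTC_ray (fun t => f (rV_cons (t, y))) (fun t => D (rV_cons (t, y))) c K).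
- by move=> t; apply: continuous_comp; [exact: rV_cons_continuousl|exact: cD].
- move=> t; apply: (@is_derive_comp_affine R _ (fun t : R => rV_cons (t, y)) f _ _
    (delta_mx 0 ord0)) => //.
  by move=> h; exact: rV_cons_delta0.
- by move=> t Kt; apply/f0/cube_rV_consl.
- by move=> t Kt; apply/D0/cube_rV_consl.
Qed.

Lemma integral_partial_derivative n (f D : 'rV[R]_n -> R) i K :
  partial_derivative_cube f D i K -> (\int[lebesgue_rV n]_x (D x)%:E = 0)%E.
Proof.
elim: n f D i => [f D [] //|n IH f D i fDi]; have [cD dD f0 D0] := fDi.
have [M DM] := continuous_bounded_cube cD D0.
have intD := integrable_bounded_cube (continuous_measurable_rV cD) DM D0.
have [F1 F2] := fubini_rV intD.
case: (unliftP ord0 i) => [j|] ij; rewrite ij in fDi.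
  rewrite F1; apply: integral0_eq => t _.
  exact: (IH _ _ j (partial_derivative_consr t fDi)).
rewrite F2; apply: integral0_eq => y _.
(* The ray starts to the left of the support: f vanishes at its origin, and the cut-off equals 1
   wherever D is nonzero. *)
have K1 : K < `|- (`|K| + 1)|.
  by rewrite normrN (lt_le_trans _ (ler_norm _))// ltr_pwDr// ler_norm.
have := FTC_ray_rV (- (`|K| + 1)) y fDi.
rewrite f0 ?oppr0; last exact: cube_rV_consl.
move=> FTC0; apply: etrans FTC0; apply: eq_integral => t _.
case: leP => [|tK]; first by rewrite mul1r.
rewrite D0 ?mulr0//; apply: cube_rV_consl.
have := ler_norm (- t); have := ler_norm K; rewrite normrN; lra.
Qed.

Section half_space.
Variables (n : nat) (c : R).
Implicit Types f D : 'rV[R]_n.+1 -> R.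

Lemma integrable_half_space f D i K : partial_derivative_cube f D i K ->
  (lebesgue_rV n.+1).-integrable setT (fun x => ((c <= x 0 ord0)%R%:R * D x)%:E).
Proof.
move=> [cD dD f0 D0]; have [M DM] := continuous_bounded_cube cD D0.
apply: (@integrable_bounded_cube _ _ (fun x => (c <= x 0 ord0)%R%:R * D x) K M).
- apply: measurable_funM; last exact: continuous_measurable_rV.
  have mb : measurable_fun setT (fun x : 'rV[R]_n.+1 => (c <= x 0 ord0)%R).
    by apply: measurable_fun_ler => //; exact: measurable_rV_coord.
  rewrite (_ : (fun x => _) = \1_[set x : 'rV[R]_n.+1 | c <= x 0 ord0]).
    apply: measurable_indic.
    rewrite (_ : [set x | _] = (fun x : 'rV[R]_n.+1 => (c <= x 0 ord0)%R) @^-1` [set true]) //.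
    by rewrite -[_ @^-1` _]setTI; exact: mb.
  apply/funext => x; rewrite indicE; congr (_%:R)%R; congr nat_of_bool.
  by apply/idP/idP; rewrite inE.
- move=> x; case: (c <= x 0 ord0); rewrite ?mul1r ?mul0r// normr0.
  exact: le_trans (DM x).
- by move=> x /D0 ->; rewrite mulr0.
Qed.

(** The cut-off depends on the first coordinate alone, so it is constant on each slice, where a
    tangential derivative integrates to 0. Only the normal derivative leaves a flux through the
    hyperplane. *)
Lemma integral_half_space_lift f D j K : partial_derivative_cube f D (lift ord0 j) K ->
  (\int[lebesgue_rV n.+1]_x ((c <= x 0 ord0)%R%:R * D x)%:E = 0)%E.
Proof.
move=> fD; have [-> _] := fubini_rV (integrable_half_space fD).
apply: integral0_eq => t _; under eq_integral do rewrite rV_cons_0.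
case: (c <= t); last by apply: integral0_eq => y _; rewrite mul0r.
under eq_integral do rewrite mul1r.
exact: (integral_partial_derivative (partial_derivative_consr t fD)).
Qed.

Lemma integral_half_space_0 f D K : partial_derivative_cube f D ord0 K ->
  (\int[lebesgue_rV n.+1]_x ((c <= x 0 ord0)%R%:R * D x)%:E =
   \int[lebesgue_rV n]_y (- f (rV_cons (c, y)))%:E)%E.
Proof.
move=> fD; have [_ ->] := fubini_rV (integrable_half_space fD).
apply: eq_integral => y _; rewrite -(FTC_ray_rV c y fD).
by apply: eq_integral => t _; rewrite rV_cons_0.
Qed.

End half_space.
End divergence_theorem.

(** * Caps *)

Section test_functions.
Context {R : realType}.

(** The complement of the closed support is open, so phi vanishes on a neighbourhood of x and its
    derivatives vanish at x as well. *)
Lemma test_field_outside n (Omega : set 'rV[R]_n) (phi : 'rV[R]_n -> 'rV[R]_n) x :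
  test_field Omega phi -> ~ Omega x -> phi x = 0 /\ jacobian phi x = 0.
Proof.
move=> [[dphi _] _ supp _] nOx.
have nS : ~ closure [set x | phi x != 0] x by move=> /supp.
have near0 : \near x, phi x = cst 0 x.
  have : nbhs x (~` closure [set x | phi x != 0]).
    by apply: open_nbhs_nbhs; split => //; apply: closed_openC; exact: closed_closure.
  apply: filterS => y nSy; apply/eqP; apply: contrapT => /negP phiy.
  by apply: nSy; exact: subset_closure.
split; first exact: nbhs_singleton near0.
apply/matrixP => i j; rewrite mxE.
have := deriveEjacobian (delta_mx 0 i) (dphi x).
rewrite (near_eq_derive _ near0) derive_cst -rowE => /rowP/(_ j).
by rewrite !mxE.
Qed.

Lemma is_derive_coord n m (phi : 'rV[R]_n -> 'rV[R]_m) x v j : differentiable phi x ->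
  is_derive x v (fun x => phi x 0 j) ((v *m jacobian phi x) 0 j).
Proof.
move=> dphi.
have /cvg_ex[l hl] : derivable phi x v by exact: diff_derivable.
have lE : l = v *m jacobian phi x.
  by rewrite -(deriveEjacobian v dphi); apply/esym/cvg_lim.
have cj :
    (fun h : R => h^-1 *: (((fun x => phi x 0 j) \o shift x) (h *: v) - phi x 0 j)) @ 0^'
    --> l 0 j.
  rewrite (_ : (fun h => _) = (fun M : 'rV[R]_m => M 0 j) \o
      (fun h : R => h^-1 *: ((phi \o shift x) (h *: v) - phi x))).
    by apply: (cvg_comp _ _ hl); exact: coord_continuous.
  by apply/funext => h; rewrite /= !mxE.
rewrite -lE; split; first by apply/cvg_ex; exists (l 0 j).
exact: cvg_lim.
Qed.

Lemma test_field_partial n (Omega : set 'rV[R]_n) (phi : 'rV[R]_n -> 'rV[R]_n) i K :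
  test_field Omega phi -> Omega `<=` cube n K ->
  partial_derivative_cube (fun x => phi x 0 i) (fun x => jacobian phi x i i) i K.
Proof.
move=> tphi OK; have [[dphi cJ] _ _ _] := tphi; split.
- move=> x; apply: (@continuous_comp _ _ _ (jacobian phi) (fun M : 'M[R]_n => M i i)).
    exact: cJ.
  exact: coord_continuous.
- move=> x.
  have -> : jacobian phi x i i = ((delta_mx 0 i : 'rV[R]_n) *m jacobian phi x) 0 i.
    by rewrite -rowE [RHS]mxE.
  exact: is_derive_coord.
- by move=> x xK; have [-> _] := test_field_outside tphi (fun h => xK (OK _ h)); rewrite mxE.
- by move=> x xK; have [_ ->] := test_field_outside tphi (fun h => xK (OK _ h)); rewrite mxE.
Qed.

Definition cap n (c : R) (x : 'rV[R]_n.+1) : R := (c <= x 0 ord0)%R%:R.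

Lemma measurable_cap_set n (c : R) : measurable [set x : 'rV[R]_n.+1 | c <= x 0 ord0].
Proof.
rewrite (_ : [set x | _] = rV_coord ord0 @^-1` `[c, +oo[%classic).
  by rewrite -[_ @^-1` _]setTI; exact: measurable_rV_coord.
by apply/seteqP; split => x; rewrite /= in_itv/= andbT.
Qed.

Lemma cap_indic n (c : R) : cap c = \1_[set x : 'rV[R]_n.+1 | c <= x 0 ord0].
Proof.
apply/funext => x; rewrite /cap indicE; congr (_%:R)%R; congr nat_of_bool.
by apply/idP/idP; rewrite inE.
Qed.

Lemma dist_variation_cap n (Omega : set 'rV[R]_n.+1) K c : open Omega ->
  Omega `<=` cube n.+1 K ->
  (dist_variation Omega (cap c) <= lebesgue_rV n (slice c Omega))%E.
Proof.
move=> oO OK; have mO := open_measurable_rV oO.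
have msl : measurable (slice c Omega) by exact: measurable_slice.
apply: ge_ereal_sup => _ [phi tphi <-].
have part i := test_field_partial i tphi OK.
apply: (@le_trans _ _ (\int[lebesgue_rV n.+1]_x
  (\sum_(i < n.+1) ((c <= x 0 ord0)%R%:R * jacobian phi x i i)%:E))%E).
  (* As the jacobian vanishes off Omega, the integral extends to the whole half-space and the
     boundary of Omega produces no term. *)
  rewrite le_eqVlt; apply/orP; left; apply/eqP.
  rewrite [LHS]integral_mkcond; apply: eq_integral => x _; rewrite patchE sumEFin -mulr_sumr.
  have [Ox|nOx] := pselect (Omega x); first by rewrite mem_set.
  rewrite memNset//; have [_ J0] := test_field_outside tphi nOx.
  by rewrite big1 ?mulr0// => i _; rewrite J0 mxE.
rewrite integral_sum//; last by move=> i; exact: (integrable_half_space c (part i)).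
rewrite big_ord_recl big1 ?adde0; last first.
  by move=> i _; exact: (integral_half_space_lift c (part (lift ord0 i))).
rewrite (integral_half_space_0 c (part ord0)).
have [_ _ _ phi1] := tphi.
have intS : (lebesgue_rV n).-integrable setT (EFin \o \1_(slice c Omega)).
  apply: (@integrable_bounded_cube _ _ _ K 1).
  - exact: measurable_indic.
  - by move=> y; rewrite indicE ger0_norm// lern1 leq_b1.
  - by move=> y yK; rewrite indicE memNset// => /(slice_cube OK).
rewrite -[leRHS](_ : \int[lebesgue_rV n]_y (\1_(slice c Omega) y)%:E = _)%E; last first.
  by rewrite integral_indic// setIT.
have phi_c y : `|phi (rV_cons (c, y)) 0 ord0| <= \1_(slice c Omega) y.
  rewrite indicE; have [Oy|nOy] := pselect (slice c Omega y).
    by rewrite mem_set// (le_trans (enorm_coord _ _)).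
  by rewrite memNset//; have [-> _] := test_field_outside tphi nOy; rewrite mxE normr0.
apply: le_integral => //.
- apply: (@integrable_bounded_cube _ _ (fun y => - phi (rV_cons (c, y)) 0 ord0) K 1).
  + apply: measurableT_comp => //; apply: continuous_measurable_rV => y.
    apply: (@continuous_comp _ _ _ (fun y => phi (rV_cons (c, y)))
      (fun M : 'rV[R]_n.+1 => M 0 ord0)); last exact: coord_continuous.
    apply: continuous_comp; first exact: rV_cons_continuousr.
    by apply: differentiable_continuous; have [[]] := tphi.
  + move=> y; rewrite normrN (le_trans (phi_c y))// indicE lern1 leq_b1 //.
  + move=> y yK; apply/eqP; rewrite oppr_eq0 -normr_le0 (le_trans (phi_c y))//.
    by rewrite indicE memNset// => /(slice_cube OK).
move=> y _; rewrite lee_fin; apply: le_trans (phi_c y).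
by rewrite -normrN ler_norm.
Qed.

Lemma BV_cap n (Omega : set 'rV[R]_n.+1) K c : open Omega ->
  Omega `<=` cube n.+1 K -> BV Omega (cap c).
Proof.
move=> oO OK; have mO := open_measurable_rV oO; split; last first.
  apply: le_lt_trans (dist_variation_cap c oO OK) _.
  rewrite -ge0_fin_numE//; apply: (@lebesgue_fin _ _ K); first exact: measurable_slice.
  exact: slice_cube.
rewrite cap_indic; have mcap := @measurable_cap_set n c.
apply/integrableP; split; first by apply/measurable_EFinP; exact: measurable_indic.
under eq_integral => x _ do rewrite /= ger0_norm//.
rewrite integral_indic// -ge0_fin_numE//; apply: (@lebesgue_fin _ _ K).
  exact: measurableI.
by move=> x [_ /OK].
Qed.

End test_functions.

(** * Trace of the indicator of a cap *)

Section trace_of_cap.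
Context {R : realType}.

Definition box n (z : 'rV[R]_n) (s : R) : set 'rV[R]_n :=
  [set x | forall i, `|x 0 i - z 0 i| <= s].

Lemma measurable_box n (z : 'rV[R]_n) s : measurable (box z s).
Proof.
rewrite (_ : box z s =
    \bigcap_(i in [set: 'I_n]) (rV_coord i @^-1` `[z 0 i - s, z 0 i + s]%classic)).
  apply: fin_bigcap_measurable => // i _.
  by rewrite -[_ @^-1` _]setTI; exact: measurable_rV_coord.
apply/seteqP; split => x h i; first by move=> _; rewrite /= in_itv/= -lter_distl; exact: h.
by have := h i I; rewrite /= in_itv/= -lter_distl.
Qed.

Lemma lebesgue_box n (z : 'rV[R]_n) s : 0 <= s ->
  lebesgue_rV n (box z s) = ((2 * s) ^+ n)%:E.
Proof.
move=> s0; elim: n z => [|n IH] z.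
  by rewrite /= diracE mem_set// => -[].
have E : @rV_cons R n @^-1` (box z s) =
    `[z 0 ord0 - s, z 0 ord0 + s]%classic `*` box (rV_tail z) s.
  apply/seteqP; split => -[t y] /=.
    move=> h; split; first by have := h ord0; rewrite rV_cons_0 in_itv/= -lter_distl.
    by move=> i; have := h (lift ord0 i); rewrite rV_cons_lift mxE.
  move=> -[+ h2] i; rewrite in_itv/= -lter_distl => h1.
  case: (unliftP ord0 i) => [j|] ->; rewrite ?rV_cons_lift ?rV_cons_0//.
  by have := h2 j; rewrite mxE.
rewrite [LHS]/= /lebesgue_rV_succ /pushforward E.
rewrite product_measure2E//; last exact: measurable_box.
rewrite IH exprS EFinM; congr (_ * _)%E.
have := lebesgue_measure_itv `[z 0 ord0 - s, z 0 ord0 + s]; rewrite /= => ->.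
rewrite lte_fin; case: ifPn => [_|].
  by rewrite -EFinD; congr EFin; ring.
rewrite -leNgt => s0'; congr EFin; lra.
Qed.

(* Near a boundary point, Omega contains a cone around the direction e of the
   Lipschitz frame. *)
Lemma lipschitz_lower_density n (Omega : set 'rV[R]_n) x : (0 < n)%N ->
  lipschitz_boundary Omega -> boundary Omega x ->
  exists r0 s : R, [/\ 0 < r0, 0 < s & forall r, 0 < r -> r < r0 ->
    exists z, box z (s * r) `<=` Omega `&` eball x r].
Proof.
move=> n0 lipO bx; have [r0 [P [e [g [L [r00 [_ eP ee] gL gO]]]]]] := lipO x bx.
pose CP := \sum_i \sum_j `|P i j|.
have CP0 : 0 <= CP by apply: sumr_ge0 => i _; apply: sumr_ge0.
(* The box is centred at y + t r e, with y in Omega close to x. Its points differ from x by three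
   vectors of sup norm at most t r; as the Euclidean norm is at most n times the sup norm, t = 1 /
   (4 n) keeps them within 3 r / 4 of x. *)
pose t : R := (n%:R * 4)^-1.
have n0R : 0 < n%:R :> R by rewrite ltr0n.
have t0 : 0 < t by rewrite invr_gt0 mulr_gt0.
(* For a displacement w of sup norm at most s r, n s r bounds the loss of height along e and the
   term with L bounds the rise of g. As s q = t, the shift t r e compensates both. *)
pose q : R := 1 + n%:R + `|L| * (n.-1%:R * CP).
have q1 : 1 <= q.
  by rewrite /q -addrA lerDl addr_ge0// mulr_ge0// mulr_ge0.
have q0 : 0 < q by rewrite (lt_le_trans ltr01).
pose s := t / q.
have s0 : 0 < s by rewrite divr_gt0.
have sq : s * q = t by rewrite /s mulfVK// gt_eqF.
have st : s <= t by rewrite -sq ler_peMr// ltW.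
exists r0, s; split => // r rpos rr0.
have [y [Oy yx]] : exists y, Omega y /\ `|y - x| < t * r.
  have [clx _] := bx; have := clx (ball x (t * r)) (nbhsx_ballx _ _ (mulr_gt0 t0 rpos)).
  move=> [y [Oy /ball_rV xy]]; exists y; split => //.
  by rewrite distrC.
have e1 : `|e| <= 1.
  apply: le_trans (normr_enorm e) _; rewrite /enorm -sqrtr1 ler_sqrt//.
  have := congr1 (fun M : 'M[R]_(1, 1) => M 0 0) ee; rewrite !mxE eqxx mulr1n => <-.
  by apply: ler_sum => i _; rewrite mxE expr2.
exists (y + (t * r) *: e) => v hv.
pose w := v - (y + (t * r) *: e).
have vE : v = y + (t * r) *: e + w by rewrite addrC subrK.
have wsr : `|w| <= s * r.
  apply: normr_le_coord; first by rewrite ltW// mulr_gt0.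
  by move=> i; have := hv i; rewrite !mxE.
clearbody w.
have tr0 : 0 < t * r by rewrite mulr_gt0.
have vx : enorm (v - x) < r.
  apply: le_lt_trans (enorm_le _) _.
  have : `|v - x| < 3 * (t * r).
    rewrite (_ : v - x = (y - x) + ((t * r) *: e + w)); last first.
      by rewrite vE -[y + _ + w]addrA addrAC.
    have h1 := ler_normD (y - x) ((t * r) *: e + w).
    have h2 := ler_normD ((t * r) *: e) w.
    have h3 : `|(t * r) *: e| <= t * r.
      by rewrite normrZ gtr0_norm// ler_piMr// ltW.
    have h4 : s * r <= t * r by rewrite ler_pM2r.
    lra.
  rewrite -(ltr_pM2l n0R) => /lt_le_trans; apply.
  rewrite (_ : n%:R * (3 * (t * r)) = (3 / 4) * r); last by rewrite /t; field; rewrite gt_eqF.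
  by rewrite ler_piMl ?ltW//; lra.
have yx' : enorm (y - x) < r.
  apply: le_lt_trans (enorm_le _) _; rewrite -(ltr_pM2l n0R) in yx.
  apply: lt_le_trans yx _.
  rewrite (_ : n%:R * (t * r) = (1 / 4) * r); last by rewrite /t; field; rewrite gt_eqF.
  by rewrite ler_piMl ?ltW//; lra.
split => //.
have [gy _] := gO y (lt_trans yx' rr0); move: gy => /(_ Oy) gy.
have [_ gOv] := gO v (lt_trans vx rr0); apply: gOv.
have wP i : `|(w *m P^T) 0 i| <= s * r * CP.
  rewrite mxE; apply: le_trans (ler_norm_sum _ _ _) _.
  apply: (@le_trans _ _ (\sum_j s * r * `|P i j|)).
    apply: ler_sum => j _; rewrite normrM mxE ler_wpM2r//.
    exact: le_trans (normr_coord w j) wsr.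
  rewrite -mulr_sumr ler_wpM2l//; first by rewrite ltW// mulr_gt0.
  by rewrite /CP [leRHS](bigD1 i)//= lerDl sumr_ge0// => k _; rewrite sumr_ge0.
have sr0 : 0 <= s * r by rewrite ltW// mulr_gt0.
have gv : g (v *m P^T) <= g (y *m P^T) + s * r * (`|L| * (n.-1%:R * CP)).
  have vP : v *m P^T - y *m P^T = w *m P^T.
    by rewrite vE !mulmxDl -scalemxAl eP scaler0 addr0 addrAC subrr add0r.
  have := gL (v *m P^T) (y *m P^T); rewrite vP => gvy.
  rewrite -lerBlDl (le_trans (ler_norm _))// (le_trans gvy)//.
  apply: (@le_trans _ _ (`|L| * enorm (w *m P^T))).
    by rewrite ler_wpM2r ?enorm_ge0// ler_norm.
  rewrite mulrCA ler_wpM2l// mulrCA; apply: le_trans (enorm_le _) _.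
  by rewrite ler_wpM2l//; apply: normr_le_coord => //; rewrite mulr_ge0.
have we : - (s * r * n%:R) <= (w *m e^T) 0 0.
  rewrite lerNl (le_trans (ler_norm _))// normrN mxE (le_trans (ler_norm_sum _ _ _))//.
  apply: (@le_trans _ _ (\sum_(j < n) s * r)).
    apply: ler_sum => j _; rewrite normrM mxE -[leRHS]mulr1 ler_pM//.
      exact: le_trans (normr_coord w j) wsr.
    exact: le_trans (normr_coord e j) e1.
  by rewrite sumr_const card_ord mulr_natr.
have -> : (v *m e^T) 0 0 = (y *m e^T) 0 0 + t * r + (w *m e^T) 0 0.
  by rewrite vE !mulmxDl -scalemxAl ee !mxE/= mulr1n mulr1.
have key : s * r * (`|L| * (n.-1%:R * CP)) + s * r * n%:R + s * r = t * r.
  by rewrite -sq /q; ring.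
move: key gv we gy sr0; lra.
Qed.

(** Near x the cap indicator is constantly 1, so 1 is a trace value. Since [bv_trace] selects some
    trace value by [xget], uniqueness is needed: the boxes of [lipschitz_lower_density] keep the
    defining quotient of l above a fixed multiple of |1 - l|. *)
Lemma cap_trace n (Omega : set 'rV[R]_n.+1) c x : open Omega ->
  lipschitz_boundary Omega -> boundary Omega x -> c < x 0 ord0 ->
  bv_trace Omega (cap c) x = 1.
Proof.
move=> oO lipO bx cx; have mO := open_measurable_rV oO.
have capE r y : r < x 0 ord0 - c -> eball x r y -> cap c y = 1.
  move=> rc; rewrite /eball/= => yx; rewrite /cap.
  have := le_lt_trans (enorm_coord (y - x) ord0) yx.
  rewrite !mxE ltr_norml => /andP[h _].
  by rewrite (_ : (c <= y 0 ord0)%R)//; lra.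
have xc0 : 0 < x 0 ord0 - c by rewrite subr_gt0.
have tr1 : is_trace_value Omega (cap c) x 1.
  apply: cvg_near_cst; near=> r.
  have rc : r < x 0 ord0 - c by near: r; exact: nbhs_right_lt.
  rewrite integral0_eq ?mule0// => y [_ xy].
  by rewrite (capE r)// subrr normr0.
rewrite /bv_trace; case: xgetP => [l _ trl|/(_ _ tr1)//].
apply/eqP; rewrite eq_sym -subr_eq0 -normr_le0.
have [r0 [s [r00 s0 hbox]]] := lipschitz_lower_density (ltn0Sn n) lipO bx.
have k0 : 0 < (2 * s) ^+ n.+1 by rewrite exprn_gt0// mulr_gt0.
suff : (((2 * s) ^+ n.+1 * `|1 - l|)%:E <= 0)%E.
  by rewrite lee_fin pmulr_rle0.
apply: (cvge_ge _ trl); near=> r.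
have r0' : 0 < r by near: r; exact: nbhs_right_gt.
have [|z hz] := hbox r r0'; first by near: r; exact: nbhs_right_lt.
have rc : r < x 0 ord0 - c by near: r; exact: nbhs_right_lt.
have mB : measurable (box z (s * r)) by exact: measurable_box.
apply: (@le_trans _ _ ((r ^- n.+1)%:E * \int[lebesgue_rV n.+1]_(y in box z (s * r)) `|1 - l|%:E)%E).
  rewrite integral_cst// lebesgue_box; last by rewrite ltW// mulr_gt0.
  rewrite -!EFinM lee_fin le_eqVlt; apply/orP; left; apply/eqP.
  have rn0 : r ^+ n.+1 != 0 by rewrite expf_neq0// gt_eqF.
  rewrite (mulrA 2 s r) (exprMn_comm _ (mulrC (2 * s) r)).
  by move: (r ^+ n.+1) rn0 ((2 * s) ^+ n.+1) => a a0 b; field.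
have mE : measurable (Omega `&` eball x r).
  apply: measurableI => //; apply: open_measurable_rV.
  rewrite (_ : eball x r = (fun y => enorm (y - x)) @^-1` [set t | t < r])//.
  by apply: open_comp => [y _|]; [exact: enorm_continuous|exact: open_lt].
have mcap : measurable_fun setT (fun y : 'rV[R]_n.+1 => `|cap c y - l|%:E).
  apply/measurable_EFinP; apply: measurableT_comp => //.
  apply: measurable_funB => //; rewrite cap_indic; apply: measurable_indic.
  exact: measurable_cap_set.
rewrite lee_pmul2l ?lte_fin ?invr_gt0 ?exprn_gt0//.
rewrite (eq_integral (fun y => `|cap c y - l|%:E)); last first.
  move=> y; rewrite inE => /hz[_ xy]; by rewrite (capE r).
by apply: ge0_subset_integral => //; exact: measurable_funTS.
Unshelve. all: by end_near. Qed.

End trace_of_cap.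

(** * Estimate of J on caps *)

Section cap_quotient.
Context {R : realType}.
Local Notation L1 := (@lebesgue_measure R).

(** The integral of a nonnegative function is a supremum over the simple functions below it, and the
    indicator of A is one of them. Here f may be arbitrary, in particular a trace defined pointwise
    by choice. *)
Lemma measure_le_integral d (T : measurableType d) (mu : {measure set T -> \bar R})
    (D A : set T) (f : T -> \bar R) :
  measurable A -> A `<=` D -> (forall x, D x -> 0 <= f x)%E ->
  (forall x, A x -> 1 <= f x)%E -> (mu A <= \int[mu]_(x in D) f x)%E.
Proof.
move=> mA AD f0 f1; rewrite ge0_integralE//; apply: ereal_sup_ubound.
exists (indic_nnsfun R mA); last exact: sintegral_indic.
move=> x; change ((\1_A x)%:E <= (f \_ D) x)%E; rewrite indicE patchE.
have [Ax|nAx] := pselect (A x); first by rewrite !mem_set ?f1//; exact: AD.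
by rewrite (memNset nAx); case: ifPn => // /set_mem; exact: f0.
Qed.

Lemma open_slicel n (Omega : set 'rV[R]_n.+1) (y : 'rV[R]_n) t : open Omega ->
  Omega (rV_cons (t, y)) ->
  exists2 e, 0 < e & forall s, `|t - s| < e -> Omega (rV_cons (s, y)).
Proof.
move=> oO Oty; have : nbhs t [set s | Omega (rV_cons (s, y))].
  by apply: (rV_cons_continuousl (y := y) (x := t)); exact: open_nbhs_nbhs.
by move=> /nbhs_ballP[e /= e0 he]; exists e.
Qed.

(* Every ray from a point of the slice in the direction of increasing first
   coordinate leaves the bounded set Omega through its boundary. *)
Lemma slice_proj_boundary n (Omega : set 'rV[R]_n.+1) K c : open Omega ->
  Omega `<=` cube n.+1 K ->
  slice c Omega `<=` [set rV_tail x | x in boundary Omega `&` [set x | c < x 0 ord0]].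
Proof.
move=> oO OK y Ocy; pose T := [set t | Omega (rV_cons (t, y))].
have supT : has_sup T.
  split; first by exists c.
  exists K => t Tt; apply: le_trans (ler_norm _) _.
  by have := OK _ Tt ord0; rewrite rV_cons_0.
(* T is open in the line, so it cannot contain its supremum; the exit point is thus in the closure
   of Omega but outside Omega. *)
have nT : ~ T (sup T).
  move=> /(open_slicel oO)[e e0 he].
  have : T (sup T + e / 2).
    by apply: he; rewrite opprD addrA subrr add0r normrN gtr0_norm ?divr_gt0//; lra.
  by move=> /(sup_ubound (proj2 supT)); lra.
exists (rV_cons (sup T, y)); last by rewrite rV_consK.
split; last first.
  rewrite /= rV_cons_0 lt_neqAle (sup_ubound (proj2 supT))// andbT.
  by apply/eqP => cT; apply: nT; rewrite -cT.
split; last by move=> /interior_subset.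
move=> B nB; have : nbhs (sup T) [set s | B (rV_cons (s, y))].
  exact: (rV_cons_continuousl (y := y) (x := sup T)).
move=> /nbhs_ballP[e /= e0 he]; have [t Tt te] := sup_adherent e0 supT.
exists (rV_cons (t, y)); split => //; apply: he.
have := sup_ubound (proj2 supT) Tt; rewrite /ball/= => tT.
by rewrite ger0_norm ?subr_ge0//; lra.
Qed.

Lemma hausdorff_cap_boundary n (Omega : set 'rV[R]_n.+1) K c : open Omega ->
  Omega `<=` cube n.+1 K -> lipschitz_boundary Omega ->
  (lebesgue_rV n (slice c Omega) <=
   \int[hausdorff_measure n]_(x in boundary Omega) (`|bv_trace Omega (cap c) x|)%:E)%E.
Proof.
move=> oO OK lipO.
pose S := boundary Omega `&` [set x | c < x 0 ord0].
have closed_cara (C : set 'rV[R]_n.+1) : closed C -> (hausdorff n).-caratheodory C.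
  by apply: closed_caratheodory => A B eta; exact: hausdorff_metric.
have mS : (hausdorff n).-caratheodory S.
  apply: caratheodory_measurable_setI; first exact/closed_cara/boundary_closed.
  rewrite -[[set x | _]]setCK; apply: caratheodory_measurable_setC; apply: closed_cara.
  apply: open_closedC.
  change (open ((fun x : 'rV[R]_n.+1 => x 0 ord0) @^-1` [set t | c < t])).
  by apply: open_comp => [x _|]; [exact: coord_continuous|exact: open_gt].
apply: (@le_trans _ _ (hausdorff n S)).
  apply: lebesgue_le_hausdorff; last exact: slice_proj_boundary oO OK.
  by apply: measurable_slice; exact: open_measurable_rV.
apply: (@measure_le_integral _ _ (hausdorff_measure n) (boundary Omega) S) => //.
  by move=> x [].
by move=> x [bx cx]; rewrite lee_fin cap_trace// normr1.
Qed.

Definition cap_volume n (Omega : set 'rV[R]_n.+1) c :=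
  lebesgue_rV n.+1 (Omega `&` [set x | c <= x 0 ord0]).

(* If the slice areas were at most M times the cap volumes F, then integrating
   over [c, h] with h - c = 1 / (2 M) would give F c <= F c / 2. *)
Lemma slice_gt_cap_volume n (Omega : set 'rV[R]_n.+1) K M : open Omega -> Omega !=set0 ->
  Omega `<=` cube n.+1 K -> 0 < M ->
  exists c, (0 < cap_volume Omega c)%E /\
    (M%:E * cap_volume Omega c < lebesgue_rV n (slice c Omega))%E.
Proof.
move=> oO [x0 Ox0] OK M0; have mO := open_measurable_rV oO.
pose X := [set x 0 ord0 | x in Omega].
have supX : has_sup X.
  split; first by exists (x0 0 ord0), x0.
  by exists K => _ [x /OK/(_ ord0) xK <-]; exact: le_trans (ler_norm _) xK.
pose h := sup X.
have slice_ge t : h <= t -> slice t Omega = set0.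
  move=> ht; apply/seteqP; split => // y /(open_slicel oO)[e e0 he].
  have : X (t + e / 2).
    exists (rV_cons (t + e / 2, y)); last by rewrite rV_cons_0.
    by apply: he; rewrite opprD addrA subrr add0r normrN gtr0_norm ?divr_gt0//; lra.
  by move=> /(sup_ubound (proj2 supX)); rewrite -/h; lra.
have mcap c : measurable (Omega `&` [set x | c <= x 0 ord0]).
  by apply: measurableI => //; exact: measurable_cap_set.
have Ffin c : cap_volume Omega c \is a fin_num.
  by apply: (@lebesgue_fin _ _ K) => // x [/OK].
have F_gt0 c : c < h -> (0 < cap_volume Omega c)%E.
  move=> ch; have hc : 0 < h - c by rewrite subr_gt0.
  have [_ [x Ox <-]] := sup_adherent hc supX; rewrite -/h opprB addrC subrK => cx.
  have : nbhs x Omega by exact: open_nbhs_nbhs.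
  move=> /nbhs_ballP[e /= e0 he].
  (* The first bound keeps the box inside Omega, the second keeps it above height c. *)
  pose s := Num.min (e / 2) (x 0 ord0 - c).
  have s0 : 0 < s by rewrite lt_min divr_gt0// subr_gt0.
  apply: (@lt_le_trans _ _ (lebesgue_rV n.+1 (box x s))).
    by rewrite lebesgue_box ?ltW// lte_fin exprn_gt0// mulr_gt0.
  apply: le_measure; rewrite ?inE//; first exact: measurable_box.
  move=> y xy; split.
    apply: he; apply/ball_rV; apply: (@le_lt_trans _ _ (e / 2)); last by lra.
    apply: normr_le_coord => [|i]; first by rewrite ltW// divr_gt0.
    by rewrite !mxE distrC (le_trans (xy i))// ge_min lexx.
  have := xy ord0; rewrite ler_distl => /andP[xsy _] /=; apply: le_trans xsy.
  by rewrite lerBrDl -lerBrDr ge_min lexx orbT.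
apply: contrapT => /forallNP H.
have aF c : c < h -> (lebesgue_rV n (slice c Omega) <= M%:E * cap_volume Omega c)%E.
  move=> ch; rewrite leNgt; apply/negP => aFc; apply: (H c); split => //; exact: F_gt0.
pose c := h - (2 * M)^-1.
have M20 : 0 < (2 * M)^-1 by rewrite invr_gt0 mulr_gt0.
have ch : c < h by rewrite ltrBlDr ltrDl.
suff : (cap_volume Omega c <= (2^-1)%:E * cap_volume Omega c)%E.
  have := F_gt0 c ch; rewrite -(fineK (Ffin c)) -EFinM !lte_fin lee_fin; lra.
have -> : ((2^-1)%:E * cap_volume Omega c =
    \int[L1]_(t in `[c, h]) (M%:E * cap_volume Omega c))%E.
  rewrite integral_cst//.
  have := lebesgue_measure_itv `[c, h]; rewrite /= => ->.
  rewrite lte_fin ch -(fineK (Ffin c)) -!EFinM; congr EFin.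
  by rewrite /c; field; rewrite gt_eqF.
rewrite {1}/cap_volume leb_slice// [leRHS]integral_mkcond.
apply: ge0_le_integral => //.
- exact: measurable_leb_slice.
- by apply/(measurable_restrictT _ _).1 => //; exact: measurable_cst.
move=> t _; rewrite patchE.
have sub : slice t (Omega `&` [set x | c <= x 0 ord0]) `<=` slice t Omega by move=> y [].
have msub D : measurable D -> measurable (slice t D) by exact: measurable_slice.
have [tc|ct] := ltP t c.
  rewrite (_ : slice t _ = set0); last first.
    by apply/seteqP; split => // y [_ /=]; rewrite rV_cons_0 leNgt tc.
  by rewrite measure0; case: ifPn => // _; rewrite mule_ge0// lee_fin ltW.
have [th|ht] := ltP t h; last first.
  have -> : slice t (Omega `&` [set x | c <= x 0 ord0]) = set0.
    by apply/seteqP; split => //; rewrite -(slice_ge t ht).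
  by rewrite measure0; case: ifPn => // _; rewrite mule_ge0// lee_fin ltW.
rewrite mem_set/=; last by rewrite in_itv/= ct ltW.
apply: (@le_trans _ _ (lebesgue_rV n (slice t Omega))).
  by apply: le_measure; rewrite ?inE//; [exact: msub (mcap c)|exact: msub].
(* Cap volumes decrease with the height and c <= t, so the bound at t is at most the bound at c. *)
apply: le_trans (aF t th) _; rewrite lee_pmul2l//.
apply: le_measure; rewrite ?inE// => x [Ox]/= tx; split => //=; exact: le_trans tx.
Qed.

Lemma J_cap_le n (Omega : set 'rV[R]_n.+1) K beta c M : open Omega ->
  Omega `<=` cube n.+1 K -> lipschitz_boundary Omega -> beta < -1 -> 0 < M ->
  (0 < cap_volume Omega c)%E ->
  (M%:E * cap_volume Omega c < lebesgue_rV n (slice c Omega))%E ->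
  (J Omega beta (cap c) <= ((1 + beta) * M)%:E)%E.
Proof.
move=> oO OK lipO b1 M0 F0 MF; have mO := open_measurable_rV oO.
have Ffin : cap_volume Omega c \is a fin_num.
  apply: (@lebesgue_fin _ _ K); last by move=> x [/OK].
  by apply: measurableI => //; exact: measurable_cap_set.
have afin : lebesgue_rV n (slice c Omega) \is a fin_num.
  by apply: (@lebesgue_fin _ _ K); [exact: measurable_slice|exact: slice_cube].
have minb : Num.min beta 1 = beta by apply/min_idPl; lra.
have intF : (\int[lebesgue_rV n.+1]_(x in Omega) `|cap c x|%:E = cap_volume Omega c)%E.
  rewrite cap_indic; under eq_integral => x _ do rewrite ger0_norm//.
  rewrite integral_indic//; last exact: measurable_cap_set.
  by rewrite setIC.
rewrite /J minb intF -(fineK Ffin) inver.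
have f0 : 0 < fine (cap_volume Omega c) by rewrite -lte_fin fineK.
rewrite gt_eqF// lee_pdivrMr//.
apply: (@le_trans _ _ ((1 + beta)%:E * lebesgue_rV n (slice c Omega))%E); last first.
  move: MF; rewrite -(fineK afin) -(fineK Ffin) -!EFinM lte_fin lee_fin => MF.
  by rewrite -mulrA ler_nM2l ?ltW//; lra.
rewrite EFinD muleDl// mul1e; apply: leeD; first exact: dist_variation_cap oO OK.
(* Writing beta as - (- beta) exposes a nonnegative factor, and the sign turns the lower bound on
   the boundary integral into an upper bound. *)
rewrite -[beta in leLHS]opprK -[beta in leRHS]opprK [(- - _)%:E]EFinN !mulNe leeN2.
apply: lee_wpmul2l; first by rewrite lee_fin; lra.
exact: hausdorff_cap_boundary oO OK lipO.
Qed.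

Lemma cap_not_ae0 n (Omega : set 'rV[R]_n.+1) c : open Omega ->
  (0 < cap_volume Omega c)%E ->
  ~ {ae lebesgue_rV n.+1, forall x, Omega x -> cap c x = 0}.
Proof.
move=> oO F0 [Z [mZ Z0 hZ]].
have : (cap_volume Omega c <= lebesgue_rV n.+1 Z)%E.
  apply: le_measure; rewrite ?inE//.
    by apply: measurableI; [exact: open_measurable_rV|exact: measurable_cap_set].
  move=> x [Ox /= cx]; apply: hZ => /(_ Ox); rewrite /cap cx => /eqP.
  by rewrite oner_eq0.
by rewrite Z0 leNgt F0.
Qed.

End cap_quotient.

(** * The infimum of J *)

Unset Implicit Arguments.

Theorem mainTheorem6 (R : realType) (N : nat) (Omega : set 'rV[R]_N)
    (beta : R) :
  (2 <= N)%N ->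
  open Omega -> Omega !=set0 -> bounded_set Omega ->
  lipschitz_boundary Omega ->
  beta < -1 ->
  ereal_inf [set J Omega beta u | u in
    [set u | BV Omega u /\
             ~ {ae lebesgue_rV N, forall x, Omega x -> u x = 0}]] = -oo%E.
Proof.
case: N Omega => // n Omega _ oO O0 [K0 [_ hK]] lipO b1.
have OK : Omega `<=` cube n.+1 (K0 + 1).
  move=> x Ox i; apply: le_trans (normr_coord x i) _.
  by apply: (hK (K0 + 1)) => //; rewrite ltrDl.
apply: eq_ninfty => A.
have b0 : 0 < - (1 + beta) by lra.
(* This M makes (1 + beta) M equal to - |A| + (1 + beta), which is below A. *)
pose M := `|A| / (- (1 + beta)) + 1.
have M0 : 0 < M by rewrite ltr_wpDl// divr_ge0// ltW.
have [c [F0 MF]] := slice_gt_cap_volume oO O0 OK M0.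
apply: (@le_trans _ _ (J Omega beta (cap c))).
  apply: ereal_inf_lbound; exists (cap c) => //; split; first exact: BV_cap oO OK.
  exact: cap_not_ae0.
apply: le_trans (J_cap_le oO OK lipO b1 M0 F0 MF) _; rewrite lee_fin.
have -> : (1 + beta) * M = - `|A| + (1 + beta) by rewrite /M; field; lra.
by have := ler_norm (- A); rewrite normrN; lra.
Qed.
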